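(* Let $K$ be an algebraically closed field with $\operatorname{char}(K)\neq 2$, let $V$ be a $3n$-dimensional $K$-vector space, and consider the natural (diagonal) action of $\operatorname{SL}(V)$ on $S^3(V)^{\oplus 3}$, the space of triples of cubic forms. Then $$\beta(\operatorname{SL}(V),S^3(V)^{\oplus 3})\ \geq\ \tfrac{2}{3}(4^n-1).$$
   Context: $\beta(G,U)$ denotes the smallest integer $d$ such that the invariant polynomials of degree $\le d$ generate the invariant ring $K[U]^G$ as a $K$-algebra. *)

(* Defs.v *)
From HB Require Import structures.
From mathcomp Require Import all_boot all_algebra.
From mathcomp Require Import mpoly.
Set Implicit Arguments. Unset Strict Implicit. Unset Printing Implicit Defensive.
Import GRing.Theory.
Local Open Scope ring_scope.

(* A point of U is its coordinate vector 'I_N -> K, K[U] = {mpoly K[N]}.     *)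

Section Generic.
Variables (K : fieldType) (N : nat) (G : Type) (inG : G -> Prop)
          (act : G -> ('I_N -> K) -> ('I_N -> K)).

Definition is_invariant (P : {mpoly K[N]}) : Prop :=
  forall g, inG g -> forall u : 'I_N -> K, P.@[act g u] = P.@[u].

Definition in_generated_subalgebra (S : {mpoly K[N]} -> Prop)
    (P : {mpoly K[N]}) : Prop :=
  exists k (gs : k.-tuple {mpoly K[N]}),
    (forall i, S (tnth gs i)) /\ exists Q : {mpoly K[k]}, P = Q \mPo gs.

(* the invariants of degree <= d generate K[U]^G as a K-algebra
   (msize p = 1 + total degree of p, msize 0 = 0) *)
Definition invariants_generated_in_degree (d : nat) : Prop :=
  forall P, is_invariant P ->
    in_generated_subalgebra
      (fun Q => is_invariant Q /\ (msize Q <= d.+1)%N) P.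

Definition beta_ge (b : nat) : Prop :=
  forall d, invariants_generated_in_degree d -> (b <= d)%N.
End Generic.

Definition cubic_mon (m : nat) : finType :=
  {s : 'X_{1..m < 4} | mdeg s == 3%N}.

Definition coordU (m : nat) : finType := ('I_3 * cubic_mon m)%type.

Definition dimU (m : nat) : nat := #|{: coordU m}|.

Section Cubics.
Variables (K : fieldType) (m : nat).

Definition cubic_form (u : coordU m -> K) (i : 'I_3) : {mpoly K[m]} :=
  \sum_(s : cubic_mon m) u (i, s) *: 'X_[(val s : 'X_{1..m})].

Definition lin_subst (g : 'M[K]_m) : m.-tuple {mpoly K[m]} :=
  [tuple \sum_(j < m) g i j *: 'X_j | i < m].

Definition act_cubics (g : 'M[K]_m) (u : coordU m -> K) : coordU m -> K :=
  fun c => (cubic_form u c.1 \mPo lin_subst g)@_(val c.2 : 'X_{1..m}).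

Definition actU (g : 'M[K]_m) (x : 'I_(dimU m) -> K) : 'I_(dimU m) -> K :=
  fun j => act_cubics g (fun c => x (enum_rank c)) (enum_val j).

Definition inSL (g : 'M[K]_m) : Prop := \det g = 1.
End Cubics.

(* Main.v *)
Require Import Defs.
From HB Require Import structures.
From mathcomp Require Import all_boot all_algebra.
From mathcomp Require Import fingroup perm cyclic.
From mathcomp Require Import mpoly.
From mathcomp Require Import ring zify.
From Stdlib Require Import Classical.
Import GRing.Theory.
Local Open Scope ring_scope.
Set Implicit Arguments. Unset Strict Implicit. Unset Printing Implicit Defensive.

(* One cubic suffices.  In m = 3n variables let
     f = x_0^2 x_1 + x_1^2 x_2 + ... + x_(m-2)^2 x_(m-1) + x_(m-1)^3.
   If c^a is a monomial in the coefficients c_i of these m terms that occurs in the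
   restriction of an invariant, invariance under the diagonal torus forces
   2 a_0 = 2 a_i + a_(i-1) = k for 0 < i < m - 1, hence 2^(m-1) divides k and
   a_0 >= 2^(m-2) unless a = 0.  So an invariant of degree below 2^(m-2) takes the
   same value at f and at 0, and it remains to find an invariant that does not.

   That invariant is a power of the discriminant.  The polynomials vanishing on all
   singular cubics form a prime ideal I.  It contains no nonzero polynomial free of
   the coefficient of x_(m-1)^3, because singular cubics are dense modulo that
   coefficient (this uses char K <> 2); since K[U] is factorial, I is generated by
   one element P.  As f is smooth, a Macaulay determinant lies in I and is nonzero
   at f, so P(f) <> 0.  Uniqueness of P makes it a semi-invariant of GL_m, and its
   character has finite order on SL_m by the LUP decomposition. *)

(** * Factorial rings *)

Section Factorial.
Variable D : idomainType.
Implicit Types (a b p q : D) (s : seq D).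

Definition divides (p q : D) := exists c, q = c * p.

Definition prime_elt (p : D) :=
  [/\ p != 0, p \isn't a GRing.unit &
      forall a b, divides p (a * b) -> divides p a \/ divides p b].

Lemma dividesMl p a b : divides p b -> divides p (a * b).
Proof. by case=> c ->; exists (a * c); rewrite mulrA. Qed.

Lemma dividesMr p a b : divides p a -> divides p (a * b).
Proof. by rewrite mulrC; apply: dividesMl. Qed.

Lemma divides_trans q p a : divides p q -> divides q a -> divides p a.
Proof. by move=> pq [c ->]; apply: dividesMl. Qed.

Lemma divides_unit p a : a \is a GRing.unit -> divides p a ->
  p \is a GRing.unit.
Proof. by move=> ua [c e]; move: ua; rewrite e unitrM => /andP[]. Qed.

Lemma prime_divides_prod p s : prime_elt p -> divides p (\prod_(x <- s) x) ->
  exists2 x, x \in s & divides p x.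
Proof.
case=> _ pu pP; elim: s => [|x s IH].
  by rewrite big_nil => /(divides_unit (unitr1 _)); rewrite (negPf pu).
rewrite big_cons => /pP [px|/IH [y ys py]].
  by exists x; rewrite ?mem_head.
by exists y; rewrite // inE ys orbT.
Qed.

(** Factors are prime rather than irreducible, which makes the factorization unique. The count [n]
    is the induction measure when constants are extracted or cancelled. *)
Inductive prime_factored (n : nat) (a : D) : Prop :=
  PrimeFactored (s : seq D) (u : D) of size s = n & u \is a GRing.unit &
    (forall p, p \in s -> prime_elt p) & a = u * \prod_(x <- s) x.

Definition factorial_ring := forall a, a != 0 -> exists n, prime_factored n a.

Lemma prime_factored_unit u : u \is a GRing.unit -> prime_factored 0 u.
Proof. by move=> uu; apply: (@PrimeFactored _ _ [::] u) => //; rewrite big_nil mulr1. Qed.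

Lemma prime_factored_prime p : prime_elt p -> prime_factored 1 p.
Proof.
move=> pp; apply: (@PrimeFactored _ _ [:: p] 1) => //; rewrite ?unitr1 //.
- by move=> q; rewrite inE => /eqP->.
- by rewrite big_seq1 mul1r.
Qed.

Lemma prime_factoredM n m a b : prime_factored n a -> prime_factored m b ->
  prime_factored (n + m) (a * b).
Proof.
case=> s u <- uu sP -> [t v <- uv tP ->].
apply: (@PrimeFactored _ _ (s ++ t) (u * v)); rewrite ?size_cat ?unitrM ?uu //.
- by move=> p; rewrite mem_cat => /orP[/sP|/tP].
- by rewrite big_cat /= mulrACA.
Qed.

(** The prime [p] divides some listed prime [x = w * p]; primality of [x] makes [w] a unit, so [x]
    can be deleted from the list at the cost of a unit. *)
Lemma prime_factored_cancel n p a : prime_elt p -> prime_factored n (p * a) ->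
  exists2 m, (m < n)%N & prime_factored m a.
Proof.
move=> pp [s u ssz uu sP e].
have /(prime_divides_prod pp) [x xs [w ew]] : divides p (\prod_(x <- s) x).
  by exists (u^-1 * a); rewrite -mulrA [a * p]mulrC e mulKr.
have [p0 pu pP] := pp; have [x0 xu xP] := sP _ xs.
have uw : w \is a GRing.unit.
  have : divides x (w * p) by exists 1; rewrite mul1r ew.
  case/xP => [[c ec]|[c ec]].
    (* Here [x] divides [w], which would make [p] a unit. *)
    move: xu; rewrite ew ec => xu.
    have : x * (c * p) == x * 1.
      by rewrite mulr1 {2}ew ec; apply/eqP; ring.
    rewrite (inj_eq (mulfI x0)) => /eqP cp.
    by case/negP: pu; apply/unitrPr; exists c; rewrite mulrC.
  have : x * (w * c) == x * 1.
    by rewrite mulr1 {2}ew ec; apply/eqP; ring.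
  rewrite (inj_eq (mulfI x0)) => /eqP cp.
  by apply/unitrPr; exists c.
exists (size (rem x s)).
  by rewrite size_rem // -ssz prednK //; case: (s) xs.
apply: (@PrimeFactored _ _ (rem x s) (u * w)) => //.
- by rewrite unitrM uu.
- by move=> q /mem_rem; apply: sP.
- apply: (mulfI p0); rewrite e (big_rem x) //= ew.
  by ring.
Qed.

Lemma nonunit_prime_divisor a : factorial_ring -> a != 0 ->
  a \isn't a GRing.unit -> exists2 p, prime_elt p & divides p a.
Proof.
move=> fD a0 nu; have [n [s u _ uu sP e]] := fD _ a0.
case: s sP e => [|x s] sP e.
  by move: nu; rewrite e big_nil mulr1 uu.
exists x; first by apply: sP; rewrite mem_head.
by rewrite e big_cons mulrCA; apply: dividesMr; exists 1; rewrite mul1r.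
Qed.

End Factorial.

(** * Gauss's theorem on polynomials over a factorial ring *)

Section FactorialPoly.
Variable D : idomainType.
Hypothesis fD : factorial_ring D.
Implicit Types (a b c p q : D) (A B E F : {poly D}).

Lemma dividesCP c A : divides c%:P A <-> forall i, divides c A`_i.
Proof.
split=> [[B ->] i|H]; first by rewrite coefMC; exists B`_i.
(* The quotients are only known to exist, so a choice of them is built by induction for finitely
   many coefficients. *)
have [e eP] : exists e : nat -> D, forall i, (i < size A)%N -> A`_i = e i * c.
  elim: (size A) => [|n [e eP]]; first by exists (fun => 0).
  have [d ed] := H n; exists (fun i => if i == n then d else e i) => i.
  by rewrite ltnS leq_eqVlt; case: eqP => [->|_] //= /eP.
exists (\poly_(i < size A) e i); apply/polyP => i.
rewrite coefMC coef_poly; case: ltnP => [/eP //|].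
by rewrite mul0r => /(nth_default 0).
Qed.

(** Gauss's lemma: if [i] and [j] are the least indices of coefficients of [A] and [B] not divisible
    by [p], then modulo [p] the coefficient of index [i + j] of [A * B] is the product of these
    two. *)
Lemma prime_polyC p : prime_elt p -> prime_elt p%:P.
Proof.
case=> p0 pu pP; split; first by rewrite polyC_eq0.
  by rewrite poly_unitE size_polyC p0 coefC.
move=> A B /dividesCP AB; apply: NNPP => /not_or_and [nA nB].
have least C : ~ divides p%:P C -> exists2 i, ~ divides p C`_i &
    forall j, (j < i)%N -> divides p C`_j.
  move=> nC; have [i ni] : exists i, ~ divides p C`_i.
    by apply: not_all_ex_not => H; apply: nC; apply/dividesCP.
  elim/ltn_ind: i ni => i IH ni.
  case: (classic (exists2 j, (j < i)%N & ~ divides p C`_j)) => [[j ji nj]|H].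
    exact: IH ji nj.
  exists i => // j ji; apply: NNPP => nj; apply: H; by exists j.
have [i ni iP] := least _ nA; have [j nj jP] := least _ nB.
have divD a b : divides p a -> divides p b -> divides p (a + b).
  by move=> [x ->] [y ->]; exists (x + y); rewrite mulrDl.
suff : divides p (A`_i * B`_j) by case/pP.
have := AB (i + j)%N; rewrite coefM.
have ilt : (i < (i + j).+1)%N by rewrite ltnS leq_addr.
rewrite (bigD1 (Ordinal ilt)) //= addKn => -[c ec].
set S := \sum_(_ < _ | _) _ in ec.
have [d dS] : divides p S.
  apply: (big_ind (divides p)); first by exists 0; rewrite mul0r.
    exact: divD.
  move=> k; rewrite -val_eqE /= => ki; case: (ltnP k i) => [lt|ge].
    by apply/dividesMr/iP.
  apply/dividesMl/jP; rewrite ltn_subLR ?ltn_add2r; last by rewrite -ltnS.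
  by rewrite ltn_neqAle eq_sym ki.
by exists (c - d); rewrite mulrBl -ec -dS addrK.
Qed.

(** Content one, phrased without gcds; over a field every polynomial qualifies. *)
Definition primitive A := forall p, prime_elt p -> ~ divides p%:P A.

(** Each constant prime pulled out also divides the leading coefficient, whose number of prime
    factors then drops. *)
Lemma primitive_part A : A != 0 ->
  exists c B, [/\ c != 0, A = c%:P * B & primitive B].
Proof.
move=> A0; have lc0 : lead_coef A != 0 by rewrite lead_coef_eq0.
have [n nA] := fD lc0.
elim/ltn_ind: n A A0 {lc0} nA => n IH A A0 nA.
case: (classic (primitive A)) => [pA|].
  by exists 1, A; rewrite oner_eq0 mul1r.
move=> /not_all_ex_not H; have [p Hp] := H.
have [pp /NNPP [B eA]] := imply_to_and _ _ Hp.
have [p0 _ _] := pp.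
have B0 : B != 0 by apply: contraNneq A0; rewrite eA => ->; rewrite mul0r.
rewrite eA lead_coefM lead_coefC mulrC in nA.
have [m mn mB] := prime_factored_cancel pp nA.
have [c [C [c0 eB pC]]] := IH _ mn _ B0 mB.
exists (p * c), C; split=> //; first by rewrite mulf_neq0.
by rewrite eA eB polyCM mulrC mulrA.
Qed.

(** In [c%:P * B = C * A] each prime factor of [c] divides [C], since it cannot divide [A];
    cancelling them one by one leaves a unit. *)
Lemma primitive_cancel c A B : primitive A -> c != 0 ->
  divides A (c%:P * B) -> divides A B.
Proof.
move=> pA c0; have [n nc] := fD c0.
elim: n c B {c0} nc => [|n IH] c B [s u ssz uu sP ->].
  move/size0nil: ssz => ->; rewrite big_nil mulr1 => -[C eC].
  exists (u^-1%:P * C); rewrite -mulrA -eC mulrA -polyCM mulVr //.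
  by rewrite mul1r.
case: s ssz sP => // x s [ssz] sP [C]; rewrite big_cons mulrCA polyCM.
set c' := u * _ => eC; have xP : prime_elt x by apply: sP; rewrite mem_head.
have [_ _ dP] := prime_polyC xP.
have /dP [[C' eC']|/(pA _ xP)//] : divides x%:P (C * A).
  by exists (c'%:P * B); rewrite -eC; ring.
apply: (IH c').
  by apply: (@PrimeFactored _ _ _ s u) => // p ps; apply: sP; rewrite inE ps orbT.
exists C'; apply: (@mulfI _ x%:P); first by rewrite polyC_eq0; case: xP.
transitivity (C * A); [rewrite -eC; ring | rewrite eC'; ring].
Qed.

(** Euclid's algorithm over the fraction field with denominators cleared: pseudo-division shrinks a
    nonzero combination [E] of [A] and [B] until it is constant or divides both up to constants. *)
Lemma bezout_or_common_divisor A B : A != 0 ->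
  (exists e, e != 0 /\ exists U V, e%:P = U * A + V * B) \/
  exists E, [/\ (1 < size E)%N, divides E A & divides E B].
Proof.
move=> A0.
suff H n E : (size E <= n)%N -> E != 0 -> (exists U V, E = U * A + V * B) ->
  (exists e, e != 0 /\ exists U V, e%:P = U * A + V * B) \/
  exists E, [/\ (1 < size E)%N, divides E A & divides E B].
  apply: (H (size A) A) => //; exists 1, 0; by rewrite mul1r mul0r addr0.
elim: n E => [|n IH] E szE E0 UV.
  by move: E0; rewrite -size_poly_eq0; case: (size E) szE.
case: (leqP (size E) 1) => [/size1_polyC eE|szE1].
  left; exists E`_0; split; first by rewrite -polyC_eq0 -eE.
  by rewrite -eE.
have [U [V eUV]] := UV.
have red C U' V' : C = U' * A + V' * B ->
    (exists2 c, c != 0 & divides E (c%:P * C)) \/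
    exists2 R : {poly D}, (size R <= n)%N & R != 0 /\ exists U V, R = U * A + V * B.
  move=> eC; have := Pdiv.Idomain.divp_eq C E.
  have lcE : lead_coef E ^+ scalp C E != 0.
    by rewrite expf_neq0 // lead_coef_eq0.
  set c := lead_coef E ^+ _ in lcE *; rewrite -mul_polyC => eq.
  have [R0|R0] := eqVneq (modp C E) 0.
    by left; exists c => //; exists (divp C E); rewrite eq R0 addr0.
  right; exists (modp C E).
    by rewrite -ltnS; apply: leq_trans szE; rewrite ltn_modp.
  split=> //; exists (c%:P * U' - (divp C E) * U), (c%:P * V' - (divp C E) * V).
  have -> : modp C E = c%:P * C - divp C E * E by rewrite eq addrC addKr.
  transitivity (c%:P * (U' * A + V' * B) - divp C E * (U * A + V * B)).
    by rewrite -eC -eUV.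
  by ring.
have eA : A = 1 * A + 0 * B by rewrite mul1r mul0r addr0.
have eB : B = 0 * A + 1 * B by rewrite mul1r mul0r add0r.
case: (red _ _ _ eA) => [[c c0 cA]|[R szR [R0 RP]]]; last exact: IH szR R0 RP.
case: (red _ _ _ eB) => [[d d0 dB]|[R szR [R0 RP]]]; last exact: IH szR R0 RP.
(* The primitive part of [E] divides [A] and [B] themselves, because the constants [c] and [d] can
   be cancelled. *)
have [e [E' [e0 eE pE']]] := primitive_part E0.
have dE : divides E' E by exists e%:P.
right; exists E'; split.
- by move: szE1; rewrite eE mul_polyC size_scale.
- exact: primitive_cancel pE' c0 (divides_trans dE cA).
- exact: primitive_cancel pE' d0 (divides_trans dE dB).
Qed.

Lemma primitive_unit A : primitive A -> (size A <= 1)%N -> A != 0 ->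
  A \is a GRing.unit.
Proof.
move=> pA /size1_polyC eA A0; rewrite eA polyC_eq0 in A0.
apply/negPn/negP => nu.
have nu' : A`_0 \isn't a GRing.unit.
  by apply: contra nu => nu; rewrite eA poly_unitE size_polyC A0 coefC.
have [p pp [c ec]] := nonunit_prime_divisor fD A0 nu'.
by apply: (pA _ pp); exists c%:P; rewrite -polyCM -ec -eA.
Qed.

Lemma primitive_divides A B : divides B A -> primitive A -> primitive B.
Proof. by move=> BA pA p pp pB; apply: (pA _ pp); apply: divides_trans BA. Qed.

(** When [F] divides [A * B], apply the Bezout alternative to [F] and [A]. A relation
    [e = U F + V A] shows that [F] divides [e B], hence [B]; a common factor of positive degree is
    [F] up to a unit, and then [F] divides [A]. *)
Lemma primitive_irreducible_prime F : primitive F -> (1 < size F)%N ->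
  (forall A B, F = A * B -> (size A <= 1)%N \/ (size B <= 1)%N) -> prime_elt F.
Proof.
move=> pF szF irr; have F0 : F != 0 by rewrite -size_poly_gt0; apply: ltnW.
split=> //; first by rewrite poly_unitE; case: (size F) szF => [|[]].
move=> A B [Q eQ].
case: (bezout_or_common_divisor A F0) => [[e [e0 [U [V eUV]]]]|].
  right; apply: (primitive_cancel pF e0); rewrite eUV mulrDl.
  exists (U * B + V * Q); rewrite mulrDl -!mulrA -eQ; congr (_ + _).
  by rewrite [F * B]mulrC.
move=> [E [szE [S eS] EA]]; left.
have S0 : S != 0 by apply: contraNneq F0; rewrite eS => ->; rewrite mul0r.
case: (irr _ _ eS) => [szS|]; last by rewrite leqNgt szE.
have uS : S \is a GRing.unit.
  apply: primitive_unit szS S0; apply: (primitive_divides _ pF).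
  by exists E; rewrite mulrC.
by apply: divides_trans EA; exists S^-1; rewrite eS mulKr.
Qed.

Lemma prime_factored_polyC n c : prime_factored n c -> prime_factored n c%:P.
Proof.
case=> s u <- uu sP ->; apply: (@PrimeFactored _ _ _ [seq x%:P | x <- s] u%:P).
- by rewrite size_map.
- have u0 : u != 0 by apply: contraTneq uu => ->; rewrite unitr0.
  by rewrite poly_unitE size_polyC u0 coefC.
- by move=> p /mapP [x /sP xP ->]; apply: prime_polyC.
- by rewrite polyCM rmorph_prod big_map.
Qed.

(** Once the content is removed, splitting into factors of positive degree terminates, and a
    primitive polynomial that does not split is prime. *)
Lemma factorial_poly : factorial_ring {poly D}.
Proof.
suff H n A : (size A <= n)%N -> primitive A -> A != 0 ->
    exists n, prime_factored n A.
  move=> A A0; have [c [B [c0 eA pB]]] := primitive_part A0.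
  have B0 : B != 0 by apply: contraNneq A0; rewrite eA => ->; rewrite mulr0.
  have [k kB] := H _ _ (leqnn _) pB B0; have [m mc] := fD c0.
  by exists (m + k)%N; rewrite eA; apply/prime_factoredM/kB/prime_factored_polyC.
elim: n A => [|n IH] A szA pA A0.
  by move: A0; rewrite -size_poly_eq0; case: (size A) szA.
case: (leqP (size A) 1) => [sz1|sz1].
  by exists 0; apply/prime_factored_unit/primitive_unit.
case: (classic (forall B C, A = B * C -> (size B <= 1)%N \/ (size C <= 1)%N)).
  by move=> irr; exists 1%N; apply/prime_factored_prime/primitive_irreducible_prime.
move=> /not_all_ex_not H; have [B /not_all_ex_not HB] := H.
have [C HC] := HB; have [eA /not_or_and []] := imply_to_and _ _ HC.
move=> /negP; rewrite -ltnNge => szB /negP; rewrite -ltnNge => szC.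
have B0 : B != 0 by rewrite -size_poly_gt0; apply: ltnW.
have C0 : C != 0 by rewrite -size_poly_gt0; apply: ltnW.
have eS : size A = (size B + size C).-1 by rewrite eA size_mul.
have [k kB] : exists n, prime_factored n B.
  apply: IH => //; last by apply: (primitive_divides _ pA); exists C; rewrite mulrC.
  move: szA; rewrite eS; case: (size C) szC => [|[|z]] // _.
  by rewrite !addnS /= ltnS => /(leq_trans (leq_addr _ _)).
have [m mC] : exists n, prime_factored n C.
  apply: IH => //; last by apply: (primitive_divides _ pA); exists B.
  move: szA; rewrite eS; case: (size B) szB => [|[|z]] // _.
  by rewrite !addSn /= ltnS => /(leq_trans (leq_addl _ _)).
by exists (k + m)%N; rewrite eA; apply: prime_factoredM.
Qed.

(** Such an ideal is prime of height one. It contains a prime factor [P] of a nonzero member. For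
    another member [A], a Bezout relation would put a nonzero constant in the ideal, so [P] and [A]
    share a factor of positive degree, and [P] divides that factor. *)
Lemma prime_ideal_principal_poly (I : {poly D} -> Prop) :
  (forall A B, I A -> I B -> I (A + B)) ->
  (forall A B, I B -> I (A * B)) ->
  (forall A B, I (A * B) -> I A \/ I B) ->
  (forall c, I c%:P -> c = 0) ->
  (exists2 A, A != 0 & I A) ->
  exists2 P, I P & forall A, I A -> divides P A.
Proof.
move=> ID IM Ip I0 [A0 A00 IA0].
have nu u : u \is a GRing.unit -> ~ I u.
  move=> uu Iu; have : I 1%:P by rewrite polyC1 -(mulVr uu); apply: IM.
  by move/I0/eqP; rewrite oner_eq0.
have [P pP IP] : exists2 P, prime_elt P & I P.
  have [n [s u _ uu sP eA]] := factorial_poly A00.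
  move: IA0; rewrite eA => /Ip [/(nu _ uu) //|].
  elim: s sP {eA} => [|x s IH] sP; rewrite ?big_nil ?big_cons.
    by move=> /nu; rewrite unitr1 => /(_ isT).
  case/Ip => [Ix|]; first by exists x => //; apply: sP; rewrite mem_head.
  by apply: IH => p ps; apply: sP; rewrite inE ps orbT.
exists P => // A IA; have [P0 _ Pdiv] := pP.
case: (bezout_or_common_divisor A P0) => [[e [e0 [U [V eUV]]]]|].
  have : I e%:P by rewrite eUV; apply: ID; apply: IM.
  by move/I0/eqP; rewrite (negPf e0).
move=> [E [szE [S eS] EA]]; apply: divides_trans EA.
have S0 : S != 0 by apply: contraNneq P0; rewrite eS => ->; rewrite mul0r.
have E0 : E != 0 by rewrite -size_poly_gt0; apply: ltnW.
have /Pdiv [[T eT]|//] : divides P (S * E) by exists 1; rewrite mul1r eS.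
have T0 : T != 0 by apply: contraNneq S0; rewrite eT => ->; rewrite mul0r.
(* [P] cannot divide [S], whose degree is smaller. *)
have : (size P <= size S)%N.
  rewrite eT size_mul //; move: T0; rewrite -size_poly_gt0.
  by case: (size T) => // k _; rewrite addSn /= leq_addl.
rewrite eS size_mul //; case: (size E) szE => [|[|k]] // _.
by rewrite !addnS /= leqNgt ltnS leq_addr.
Qed.

End FactorialPoly.

(** * Polynomial rings in several variables *)

Lemma eq_mpoly_rmorph n (R S : comNzRingType) (f g : {rmorphism {mpoly R[n]} -> S}) :
  (forall c, f c%:MP = g c%:MP) -> (forall i, f 'X_i = g 'X_i) -> f =1 g.
Proof.
move=> fgC fgX p; rewrite (mpolyE p) !rmorph_sum; apply: eq_bigr => s _.
rewrite -mul_mpolyC !rmorphM fgC mpolyXE_id !rmorph_prod; congr (_ * _).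
by apply: eq_bigr => i _; rewrite !rmorphXn fgX.
Qed.

Section IsolateVariable.
Variables (K : fieldType) (n : nat) (i0 : 'I_n.+1).

(** [isolate] identifies the polynomial ring with univariate polynomials in the variable [i0] over
    the ring in the others; [deisolate] is its inverse. *)
Definition isolate_var (j : 'I_n.+1) : {poly {mpoly K[n]}} :=
  if unlift i0 j is Some k then ('X_k)%:P else 'X.

Definition isolate : {mpoly K[n.+1]} -> {poly {mpoly K[n]}} :=
  mmap (polyC \o @mpolyC n K) isolate_var.
HB.instance Definition _ := GRing.RMorphism.on isolate.

Definition insert_var : {mpoly K[n]} -> {mpoly K[n.+1]} :=
  mmap (@mpolyC n.+1 K) (fun k => 'X_(lift i0 k)).
HB.instance Definition _ := GRing.RMorphism.on insert_var.

Definition deisolate : {poly {mpoly K[n]}} -> {mpoly K[n.+1]} :=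
  horner_eval 'X_i0 \o map_poly insert_var.
HB.instance Definition _ := GRing.RMorphism.on deisolate.

Lemma isolateC c : isolate c%:MP = c%:MP%:P.
Proof. by rewrite /isolate mmapC. Qed.

Lemma isolateX j : isolate 'X_j = isolate_var j.
Proof. by rewrite /isolate mmapX mmap1U. Qed.

Lemma insert_varC c : insert_var c%:MP = c%:MP.
Proof. by rewrite /insert_var mmapC. Qed.

Lemma insert_varX k : insert_var 'X_k = 'X_(lift i0 k).
Proof. by rewrite /insert_var mmapX mmap1U. Qed.

Lemma deisolateC c : deisolate c%:P = insert_var c.
Proof. by rewrite /deisolate /= map_polyC /horner_eval hornerC. Qed.

Lemma deisolateX : deisolate 'X = 'X_i0.
Proof. by rewrite /deisolate /= map_polyX /horner_eval hornerX. Qed.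

Lemma isolateK : cancel isolate deisolate.
Proof.
move=> p; apply: (@eq_mpoly_rmorph _ _ _ (deisolate \o isolate) idfun) => [c|j] /=.
  by rewrite isolateC deisolateC insert_varC.
rewrite isolateX /isolate_var; case: unliftP => [k|] ->.
  by rewrite deisolateC insert_varX.
by rewrite deisolateX.
Qed.

Lemma isolate_insert_var p : isolate (insert_var p) = p%:P.
Proof.
apply: (@eq_mpoly_rmorph _ _ _ (isolate \o insert_var) polyC) => [c|j] /=.
  by rewrite insert_varC isolateC.
by rewrite insert_varX isolateX /isolate_var liftK.
Qed.

Lemma deisolateK : cancel deisolate isolate.
Proof.
elim/poly_ind => [|p c IH]; first by rewrite !rmorph0.
rewrite !(rmorphD, rmorphM) /= IH deisolateX deisolateC isolate_insert_var.
by rewrite isolateX /isolate_var unlift_none.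
Qed.

Lemma meval_insert_var p (x : 'I_n.+1 -> K) :
  (insert_var p).@[x] = p.@[fun k => x (lift i0 k)].
Proof.
apply: (@eq_mpoly_rmorph _ _ _ (meval x \o insert_var)
  (meval (fun k => x (lift i0 k)))) => [c|j] /=.
  by rewrite insert_varC !mevalC.
by rewrite insert_varX !mevalXU.
Qed.

Lemma meval_isolate p (x : 'I_n.+1 -> K) :
  p.@[x] = (map_poly (meval (fun k => x (lift i0 k))) (isolate p)).[x i0].
Proof.
apply: (@eq_mpoly_rmorph _ _ _ (meval x)
  (horner_eval (x i0) \o map_poly (meval (fun k => x (lift i0 k))) \o isolate))
  => [c|j] /=.
  by rewrite isolateC map_polyC /= /horner_eval hornerC !mevalC.
rewrite isolateX /isolate_var; case: unliftP => [k|] -> /=.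
  by rewrite map_polyC /= /horner_eval hornerC !mevalXU.
by rewrite map_polyX /horner_eval hornerX mevalXU.
Qed.

End IsolateVariable.

Lemma factorial_ring_iso (D E : idomainType) (f : {rmorphism D -> E}) (g : {rmorphism E -> D}) :
  cancel f g -> cancel g f -> factorial_ring D -> factorial_ring E.
Proof.
move=> fK gK fD a a0.
have ga0 : g a != 0 by rewrite -(inj_eq (can_inj gK)) rmorph0 in a0 *.
have fdiv p b : divides p (g b) -> divides (f p) b.
  by move=> [c /(congr1 f)]; rewrite gK rmorphM => ->; exists (f c).
have gdiv p b : divides (f p) b -> divides p (g b).
  by move=> [c ->]; rewrite rmorphM fK; exists (g c).
have [n [s u ssz uu sP e]] := fD _ ga0.
exists n; apply: (@PrimeFactored _ _ _ [seq f x | x <- s] (f u)).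
- by rewrite size_map.
- exact: rmorph_unit.
- move=> _ /mapP [p /sP [p0 pu pP] ->]; split.
  + by rewrite -(inj_eq (can_inj gK)) fK rmorph0.
  + by apply: contra pu => /(rmorph_unit g); rewrite fK.
  + move=> b c /gdiv; rewrite rmorphM => /pP [] /fdiv; by [left | right].
- by rewrite big_map -rmorph_prod -rmorphM -e gK.
Qed.

Lemma factorial_mpoly (K : fieldType) n : factorial_ring {mpoly K[n]}.
Proof.
elim: n => [|n IH].
  move=> a a0; exists 0%N; apply: prime_factored_unit.
  rewrite (nvar0_mpolyC a) in a0 *; rewrite mpolyC_eq0 in a0.
  by apply: rmorph_unit; rewrite unitfE.
exact: factorial_ring_iso (@deisolateK K n ord0) (@isolateK K n ord0) (factorial_poly IH).
Qed.

(** That the ideal meets the ring in the other variables trivially is phrased through values, a form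
    that can be checked geometrically. *)
Lemma prime_ideal_principal (K : fieldType) N (i0 : 'I_N) (I : {mpoly K[N]} -> Prop) :
  (forall A B, I A -> I B -> I (A + B)) ->
  (forall A B, I B -> I (A * B)) ->
  (forall A B, I (A * B) -> I A \/ I B) ->
  (forall Q, (forall x y : 'I_N -> K, (forall j, j != i0 -> x j = y j) ->
                Q.@[x] = Q.@[y]) -> I Q -> Q = 0) ->
  (exists2 A, A != 0 & I A) ->
  exists2 P, I P & forall A, I A -> divides P A.
Proof.
case: N i0 I => [[] // |n] i0 I ID IM Ip I0 [A0 A00 IA0].
have [|||||P IP PP] := @prime_ideal_principal_poly _ (@factorial_mpoly K n)
  (I \o deisolate i0).
- by move=> A B IA IB /=; rewrite rmorphD; apply: ID.
- by move=> A B IB /=; rewrite rmorphM; apply: IM.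
- by move=> A B /=; rewrite rmorphM => /Ip.
- move=> c /=; rewrite deisolateC => /I0 c0; apply: polyC_inj.
  rewrite -(isolate_insert_var i0) c0 ?rmorph0 // => x y xy.
  rewrite !meval_insert_var; apply: meval_eq => k; apply: xy.
  by rewrite eq_sym neq_lift.
- exists (isolate i0 A0); last by rewrite /= isolateK.
  by rewrite -(inj_eq (can_inj (@deisolateK K n i0))) isolateK rmorph0.
exists (deisolate i0 P) => // A IA.
have [|c ec] := PP (isolate i0 A); first by rewrite /= isolateK.
by exists (deisolate i0 c); rewrite -[A](isolateK i0) ec rmorphM.
Qed.

(** A nonzero univariate polynomial over an algebraically closed field has a non-root. Hence the
    coefficients with respect to one variable vanish everywhere, and induction applies to them. *)
Lemma mpoly_eval_eq0 (K : closedFieldType) N (p : {mpoly K[N]}) :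
  (forall x, p.@[x] = 0) -> p = 0.
Proof.
elim: N p => [|n IH] p p0.
  have := p0 (fun=> 0); rewrite (nvar0_mpolyC p) mevalC => ->.
  exact: mpolyC0.
apply: (can_inj (@isolateK K n ord0)); rewrite rmorph0; apply/polyP => i.
rewrite coef0; apply: IH => x.
have : map_poly (meval x) (isolate ord0 p) = 0.
  apply/eqP/negPn/negP => /closed_nonrootP [t /negP]; apply; apply/rootP.
  rewrite -(p0 (fun j => if unlift ord0 j is Some k then x k else t)).
  rewrite (meval_isolate ord0) unlift_none; congr (_.[_]).
  by apply: eq_map_poly => q; apply: meval_eq => k; rewrite liftK.
by move/polyP/(_ i); rewrite coef_map coef0.
Qed.

Lemma mpoly_unit_const (K : fieldType) N (p : {mpoly K[N]}) :
  p \is a GRing.unit -> exists2 c, c != 0 & p = c%:MP.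
Proof.
rewrite unfold_in /= => /andP [/eqP e c0].
by exists p@_0%MM => //; rewrite -unitfE.
Qed.

(** * Functions depending polynomially on parameters *)

Section FunctionAlgebra.
Variables (K : closedFieldType) (V : Type).

(** Closure rules that replace explicit polynomials; they serve for polynomial functions of one
    variable and of several. *)
Record function_algebra (C : (V -> K) -> Prop) : Prop := FunctionAlgebra {
  fa_ext : forall F G, F =1 G -> C F -> C G;
  fa_const : forall c, C (fun => c);
  fa_add : forall F G, C F -> C G -> C (fun v => F v + G v);
  fa_mul : forall F G, C F -> C G -> C (fun v => F v * G v) }.

Variables (C : (V -> K) -> Prop) (fC : function_algebra C).

Lemma fa_sum (J : Type) (r : seq J) (P : pred J) (F : J -> V -> K) :
  (forall j, P j -> C (F j)) -> C (fun v => \sum_(j <- r | P j) F j v).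
Proof.
move=> CF; elim: r => [|j r IH].
  by apply: (fa_ext fC) (fa_const fC 0) => v; rewrite big_nil.
case Pj: (P j); last by apply: (fa_ext fC) IH => v; rewrite big_cons Pj.
by apply: (fa_ext fC) (fa_add fC (CF j Pj) IH) => v; rewrite big_cons Pj.
Qed.

Lemma fa_prod (J : Type) (r : seq J) (P : pred J) (F : J -> V -> K) :
  (forall j, P j -> C (F j)) -> C (fun v => \prod_(j <- r | P j) F j v).
Proof.
move=> CF; elim: r => [|j r IH].
  by apply: (fa_ext fC) (fa_const fC 1) => v; rewrite big_nil.
case Pj: (P j); last by apply: (fa_ext fC) IH => v; rewrite big_cons Pj.
by apply: (fa_ext fC) (fa_mul fC (CF j Pj) IH) => v; rewrite big_cons Pj.
Qed.

Lemma fa_exp F k : C F -> C (fun v => F v ^+ k).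
Proof.
move=> CF; have := @fa_prod _ (iota 0 k) predT (fun => F) (fun _ _ => CF).
by apply: (fa_ext fC) => v; rewrite big_const_seq count_predT size_iota iter_mulr mulr1.
Qed.

Lemma fa_meval N (P : {mpoly K[N]}) (x : V -> 'I_N -> K) :
  (forall j, C (fun v => x v j)) -> C (fun v => P.@[x v]).
Proof.
move=> Cx; apply: (fa_ext fC) (_ : C (fun v =>
    \sum_(s <- msupp P) P@_s * \prod_i x v i ^+ s i)).
  by move=> v; rewrite mevalE.
apply: (@fa_sum _ _ _ (fun s v => P@_s * \prod_i x v i ^+ s i)) => s _.
apply: (fa_mul fC); first exact: fa_const.
by apply: (@fa_prod _ _ _ (fun i v => x v i ^+ s i)) => i _; apply: fa_exp.
Qed.

Lemma fa_det n (M : V -> 'M[K]_n) :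
  (forall i j, C (fun v => M v i j)) -> C (fun v => \det (M v)).
Proof.
move=> CM; apply: (@fa_sum _ _ _ (fun (s : {perm 'I_n}) v => (-1) ^+ s * \prod_i M v i (s i))).
move=> s _; apply: (fa_mul fC); first exact: fa_const.
by apply: (@fa_prod _ _ _ (fun i v => M v i (s i))).
Qed.

Definition fa_coef m (F : V -> {mpoly K[m]}) := forall s, C (fun v => (F v)@_s).

Lemma fa_coef_const m (p : {mpoly K[m]}) : fa_coef (fun => p).
Proof. by move=> s; apply: fa_const. Qed.

Lemma fa_coefM m (F G : V -> {mpoly K[m]}) :
  fa_coef F -> fa_coef G -> fa_coef (fun v => F v * G v).
Proof.
move=> CF CG s; apply: (fa_ext fC) (_ : C (fun v =>
  \sum_(k : 'X_{1..m < (mdeg s).+1, (mdeg s).+1} | s == (k.1 + k.2)%MM)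
     (F v)@_k.1 * (G v)@_k.2)) => [v|]; first by rewrite mcoeffM.
apply: (@fa_sum _ _ _ (fun k v => (F v)@_(bmnm (fst k)) * (G v)@_(bmnm (snd k)))) => k _.
exact: (fa_mul fC).
Qed.

Lemma fa_coefZ m (F : V -> K) (G : V -> {mpoly K[m]}) :
  C F -> fa_coef G -> fa_coef (fun v => F v *: G v).
Proof.
move=> CF CG s; apply: (fa_ext fC) (fa_mul fC CF (CG s)) => v.
by rewrite mcoeffZ.
Qed.

Lemma fa_coef_sum m (J : Type) (r : seq J) (P : pred J) (F : J -> V -> {mpoly K[m]}) :
  (forall j, P j -> fa_coef (F j)) -> fa_coef (fun v => \sum_(j <- r | P j) F j v).
Proof.
move=> CF s; apply: (fa_ext fC) (@fa_sum _ r P (fun j v => (F j v)@_s) _).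
  by move=> v; rewrite raddf_sum.
by move=> j Pj; apply: CF.
Qed.

Lemma fa_coef_prod m (J : Type) (r : seq J) (P : pred J) (F : J -> V -> {mpoly K[m]}) :
  (forall j, P j -> fa_coef (F j)) -> fa_coef (fun v => \prod_(j <- r | P j) F j v).
Proof.
move=> CF; elim: r => [|j r IH] s.
  by apply: (fa_ext fC) (fa_coef_const 1 s) => v; rewrite big_nil.
case Pj: (P j); last by apply: (fa_ext fC) (IH s) => v; rewrite big_cons Pj.
by apply: (fa_ext fC) (fa_coefM (CF j Pj) IH s) => v; rewrite big_cons Pj.
Qed.

Lemma fa_coefX m (F : V -> {mpoly K[m]}) k :
  fa_coef F -> fa_coef (fun v => F v ^+ k).
Proof.
move=> CF s.
apply: (fa_ext fC) (@fa_coef_prod _ _ (iota 0 k) predT (fun => F) (fun _ _ => CF) s) => v.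
by rewrite big_const_seq count_predT size_iota iter_mulr mulr1.
Qed.

End FunctionAlgebra.

Definition is_mpoly_fun (K : closedFieldType) N (F : ('I_N -> K) -> K) :=
  exists p : {mpoly K[N]}, forall x, p.@[x] = F x.

Definition is_poly_fun (K : closedFieldType) (F : K -> K) :=
  exists p : {poly K}, forall t, p.[t] = F t.

Lemma mpoly_fun_algebra (K : closedFieldType) N :
  function_algebra (@is_mpoly_fun K N).
Proof.
split=> [F G FG [p pF]|c|F G [p pF] [q qG]|F G [p pF] [q qG]].
- by exists p => x; rewrite pF.
- by exists c%:MP => x; rewrite mevalC.
- by exists (p + q) => x; rewrite mevalD pF qG.
- by exists (p * q) => x; rewrite mevalM pF qG.
Qed.

Lemma poly_fun_algebra (K : closedFieldType) : function_algebra (@is_poly_fun K).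
Proof.
split=> [F G FG [p pF]|c|F G [p pF] [q qG]|F G [p pF] [q qG]].
- by exists p => x; rewrite pF.
- by exists c%:P => x; rewrite hornerC.
- by exists (p + q) => x; rewrite hornerD pF qG.
- by exists (p * q) => x; rewrite hornerM pF qG.
Qed.

(** * The action on triples of cubics *)

Lemma dhomog_bigprod (R : idomainType) n (J : Type) (r : seq J) (P : pred J)
    (F : J -> {mpoly R[n]}) (d : J -> nat) :
  (forall j, P j -> F j \is (d j).-homog) ->
  \prod_(j <- r | P j) F j \is (\sum_(j <- r | P j) d j).-homog.
Proof.
move=> H; elim/big_rec2: _ => [|j e p Pj Hp]; first exact: dhomog1.
by apply: dhomogM => //; apply: H.
Qed.

Section Action.
Variables (K : closedFieldType) (m : nat).
Local Notation N := (dimU m).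
Implicit Types (g h : 'M[K]_m) (x y : 'I_N -> K) (s : cubic_mon m).

Definition cub x (i : 'I_3) : {mpoly K[m]} := cubic_form (fun c => x (enum_rank c)) i.

Lemma mcoeff_cub x (i : 'I_3) s : (cub x i)@_(val s : 'X_{1..m}) = x (enum_rank (i, s)).
Proof.
rewrite /cub /cubic_form raddf_sum (bigD1 s) //= mcoeffZ mcoeffX eqxx mulr1.
rewrite big1 ?addr0 // => t ts; rewrite mcoeffZ mcoeffX.
by rewrite -bmeqP (inj_eq val_inj) (negPf ts) mulr0.
Qed.

Lemma cubic_monP (a : 'X_{1..m}) : mdeg a = 3 ->
  exists s : cubic_mon m, a = (val s : 'X_{1..m}).
Proof.
move=> d3; have lt4 : (mdeg a < 4)%N by rewrite d3.
have p3 : mdeg (BMultinom lt4) == 3%N by rewrite /= d3.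
by exists (Sub (BMultinom lt4) p3).
Qed.

Lemma cub_homog x (i : 'I_3) : cub x i \is 3.-homog.
Proof.
apply: rpred_sum => s _; apply: dhomogZ; rewrite dhomogX; exact: (valP s).
Qed.

Lemma eq_dhomog3 (p q : {mpoly K[m]}) : p \is 3.-homog -> q \is 3.-homog ->
  (forall s, p@_(val s : 'X_{1..m}) = q@_(val s : 'X_{1..m})) -> p = q.
Proof.
move=> hp hq pq; apply/mpolyP => a; have [/cubic_monP [s ->] //|d3] := eqVneq (mdeg a) 3%N.
by rewrite (dhomog_nemf_coeff hp d3) (dhomog_nemf_coeff hq d3).
Qed.

Lemma eq_cub x y : (forall i, cub x i = cub y i) -> x =1 y.
Proof.
move=> xy k; rewrite -(enum_valK k); case: (enum_val k) => i s.
by rewrite -!mcoeff_cub xy.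
Qed.

Lemma exists_cub (p : 'I_3 -> {mpoly K[m]}) : (forall i, p i \is 3.-homog) ->
  exists x, forall i, cub x i = p i.
Proof.
move=> hp; exists (fun k : 'I_N =>
  let c : coordU m := enum_val k in (p c.1)@_(val c.2 : 'X_{1..m})) => i.
by apply: eq_dhomog3 => [||s] //; rewrite ?cub_homog // mcoeff_cub enum_rankK.
Qed.

Lemma tnth_lin_subst g i : tnth (lin_subst g) i = \sum_(j < m) g i j *: 'X_j.
Proof. by rewrite tnth_mktuple. Qed.

Lemma comp_lin_substX g i : 'X_i \mPo lin_subst g = \sum_(j < m) g i j *: 'X_j.
Proof. by rewrite comp_mpolyXU -tnth_nth tnth_lin_subst. Qed.

Lemma comp_lin_subst_homog g d (p : {mpoly K[m]}) : p \is d.-homog ->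
  p \mPo lin_subst g \is d.-homog.
Proof.
move/dhomogP => hp; rewrite (mpolyE p) raddf_sum /= big_seq.
apply: rpred_sum => a /hp <-; rewrite comp_mpolyZ; apply: dhomogZ.
rewrite comp_mpolyX /= mdegE; apply: dhomog_bigprod => i _.
rewrite -{2}[a i]mul1n; apply: dhomogMn; rewrite tnth_lin_subst.
by apply: rpred_sum => j _; apply: dhomogZ; rewrite dhomogX; apply/eqP/mdeg1.
Qed.

Lemma cub_act g x (i : 'I_3) : cub (actU g x) i = cub x i \mPo lin_subst g.
Proof.
apply: eq_dhomog3 => [||s]; rewrite ?comp_lin_subst_homog ?cub_homog //.
by rewrite mcoeff_cub /actU /act_cubics enum_rankK.
Qed.

Lemma comp_lin_substM g h (p : {mpoly K[m]}) :
  (p \mPo lin_subst h) \mPo lin_subst g = p \mPo lin_subst (h *m g).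
Proof.
apply: (@eq_mpoly_rmorph _ _ _ (comp_mpoly (lin_subst g) \o comp_mpoly (lin_subst h))
  (comp_mpoly (lin_subst (h *m g)))) => [c|i] /=; first by rewrite !comp_mpolyC.
rewrite !comp_lin_substX raddf_sum /=.
under eq_bigr do rewrite comp_mpolyZ comp_lin_substX scaler_sumr.
rewrite exchange_big /=; apply: eq_bigr => j _.
by rewrite mxE scaler_suml; apply: eq_bigr => k _; rewrite scalerA.
Qed.

Lemma comp_lin_subst1 (p : {mpoly K[m]}) : p \mPo lin_subst 1%:M = p.
Proof.
apply: (@eq_mpoly_rmorph _ _ _ (comp_mpoly (lin_subst 1%:M)) idfun) => [c|i] /=.
  by rewrite comp_mpolyC.
rewrite comp_lin_substX (bigD1 i) //= mxE eqxx scale1r big1 ?addr0 // => j ji.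
by rewrite mxE eq_sym (negPf ji) scale0r.
Qed.

(** Substitution reverses composition, so this is a right action; on a group of matrices its
    invariants are those of the left action by inverses. *)
Lemma actUM g h x : actU g (actU h x) =1 actU (h *m g) x.
Proof. by apply: eq_cub => i; rewrite !cub_act comp_lin_substM. Qed.

Lemma actU1 x : actU 1%:M x =1 x.
Proof. by apply: eq_cub => i; rewrite cub_act comp_lin_subst1. Qed.

(** Matrix and point may both vary, which covers a fixed matrix, a line of matrices at a fixed
    point, and all pairs at once. *)
Lemma fa_act (V : Type) (C : (V -> K) -> Prop) (fC : function_algebra C)
    (g : V -> 'M[K]_m) (x : V -> 'I_N -> K) :
  (forall i j, C (fun v => g v i j)) -> (forall k, C (fun v => x v k)) ->
  forall k, C (fun v => actU (g v) (x v) k).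
Proof.
move=> Cg Cx k.
have H : fa_coef C (fun v => \sum_(s : cubic_mon m) x v (enum_rank ((enum_val k).1, s)) *:
    \prod_(i < m) (\sum_(j < m) g v i j *: 'X_j) ^+ ((val s : 'X_{1..m}) i)).
  apply: (fa_coef_sum fC) => s _; apply: (fa_coefZ fC (Cx _)).
  apply: (fa_coef_prod fC) => i _; apply: (fa_coefX fC).
  apply: (fa_coef_sum fC) => j _; apply: (fa_coefZ fC (Cg _ _)).
  exact: fa_coef_const.
apply: (fa_ext fC) (H (val (enum_val k).2 : 'X_{1..m})) => v.
rewrite /actU /act_cubics /cubic_form; congr (mcoeff _ _).
rewrite [RHS](raddf_sum (comp_mpoly (lin_subst (g v)))) /=.
apply: eq_bigr => s _; rewrite comp_mpolyZ comp_mpolyX; congr (_ *: _).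
by apply: eq_bigr => i _; rewrite tnth_lin_subst.
Qed.

Lemma pullback_exists h (P : {mpoly K[N]}) :
  exists Q : {mpoly K[N]}, forall x, Q.@[x] = P.@[actU h x].
Proof.
apply: (fa_meval (mpoly_fun_algebra K N)) => j.
apply: (fa_act (mpoly_fun_algebra K N)) => [i k|k].
  exact: (fa_const (mpoly_fun_algebra K N)).
by exists 'X_k => x; rewrite mevalXU.
Qed.

(** * The ideal of singular cubics *)

Section SingularIdeal.
Variable l : 'I_m.

(* The first cubic of [x] and its partial derivatives vanish at the [l]-th
   coordinate point: the coefficients of ['X_l ^+ 3] and ['X_l ^+ 2 * 'X_i] are 0. *)
Definition singular_at_point x :=
  forall s, (1 < (val s : 'X_{1..m}) l)%N -> x (enum_rank (ord0, s)) = 0.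

(* Letting [g] range over all matrices, not only invertible ones, exhibits this
   ideal as the kernel of a ring morphism to a polynomial ring, so it is prime. *)
Definition singular_ideal (P : {mpoly K[N]}) :=
  forall g x, singular_at_point x -> P.@[actU g x] = 0.

Lemma singular_idealD P Q :
  singular_ideal P -> singular_ideal Q -> singular_ideal (P + Q).
Proof. by move=> IP IQ g x Lx; rewrite mevalD IP // IQ // addr0. Qed.

Lemma singular_idealM P Q : singular_ideal Q -> singular_ideal (P * Q).
Proof. by move=> IQ g x Lx; rewrite mevalM IQ // mulr0. Qed.

(** Together with [param_point], this parametrizes by an affine space all pairs of a matrix and a
    point satisfying [singular_at_point]. *)
Definition param_matrix (v : 'I_(m * m + N) -> K) : 'M[K]_m :=
  \matrix_(i, j) v (lshift N (mxvec_index i j)).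

Definition param_point (v : 'I_(m * m + N) -> K) (k : 'I_N) : K :=
  let c := enum_val k in
  if (c.1 == ord0) && (1 < (val c.2 : 'X_{1..m}) l)%N then 0 else v (rshift (m * m) k).

Lemma param_pointP v : singular_at_point (param_point v).
Proof. by move=> s ls; rewrite /param_point enum_rankK /= ls. Qed.

Lemma param_surj g x : singular_at_point x ->
  exists2 v, param_matrix v = g & param_point v =1 x.
Proof.
move=> Lx; exists (fun k => match split k with inl a => mxvec g 0 a | inr b => x b end).
  apply/matrixP => i j; rewrite mxE.
  by rewrite (unsplitK (inl _ : 'I_(m * m) + 'I_N)) mxvecE.
move=> k; rewrite /param_point (unsplitK (inr _ : 'I_(m * m) + 'I_N)).
case: ifP => // /andP [c0 cl]; rewrite -[k]enum_valK.
by case: (enum_val k) c0 cl => i s /= /eqP -> ls; rewrite Lx.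
Qed.

Lemma singular_ideal_prime P Q :
  singular_ideal (P * Q) -> singular_ideal P \/ singular_ideal Q.
Proof.
have H (R : {mpoly K[N]}) : exists r : {mpoly K[m * m + N]},
    forall v, r.@[v] = R.@[actU (param_matrix v) (param_point v)].
  have fC := mpoly_fun_algebra K (m * m + N).
  apply: (fa_meval fC); apply: (fa_act fC) => [i j|k].
    by exists ('X_(lshift N (mxvec_index i j))) => v; rewrite mevalXU mxE.
  rewrite /param_point; rewrite /=; set b := (_ == _) && _; case: b.
    exact: (fa_const fC 0).
  by exists ('X_(rshift (m * m) k)) => v; rewrite mevalXU.
have Iz R r : (forall v, r.@[v] = R.@[actU (param_matrix v) (param_point v)]) ->
    r = 0 -> singular_ideal R.
  move=> er r0 g x /param_surj - /(_ g) [v <- vx].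
  have := er v; rewrite r0 meval0 => ->; apply: meval_eq => k.
  rewrite -[k]enum_valK; case: (enum_val k) => i s; rewrite -!mcoeff_cub !cub_act.
  congr ((_ \mPo _)@__); apply: eq_dhomog3 => [||t]; rewrite ?cub_homog //.
  by rewrite !mcoeff_cub vx.
move=> IPQ; have [p pP] := H P; have [q qP] := H Q.
have : p * q = 0.
  apply: mpoly_eval_eq0 => v; rewrite mevalM pP qP -mevalM.
  exact/IPQ/param_pointP.
by move/eqP; rewrite mulf_eq0 => /orP [] /eqP; [left | right]; apply: Iz; eassumption.
Qed.

(** Acting by [g] and then by [h] is acting by [g *m h], so the set of points [actU g x] is
    stable. *)
Lemma singular_ideal_pullback h P Q : singular_ideal P ->
  (forall x, Q.@[x] = P.@[actU h x]) -> singular_ideal Q.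
Proof.
move=> IP eQ g x Lx; rewrite eQ (meval_eq _ (actUM h g x)); exact: IP.
Qed.

End SingularIdeal.
End Action.

(** * Codimension of the singular locus *)

Lemma mcoeff_pihomog (R : idomainType) n d (p : {mpoly R[n]}) s :
  (pihomog mdeg d p)@_s = if mdeg s == d then p@_s else 0.
Proof.
rewrite pihomogE raddf_sum /= big_mkcond /=.
have [sp|sp] := boolP (s \in msupp p); last first.
  rewrite (memN_msupp_eq0 sp) if_same big_seq big1 // => a ap.
  case: ifP => // _; rewrite mcoeffZ mcoeffX.
  by case: eqP => [e|]; [rewrite -e ap in sp | rewrite mulr0].
rewrite (bigD1_seq s) ?msupp_uniq //= big1 => [|a sa].
  by rewrite addr0; case: ifP => // _; rewrite mcoeffZ mcoeffX eqxx mulr1.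
by case: ifP => // _; rewrite mcoeffZ mcoeffX (negPf sa) mulr0.
Qed.

(** Choose [x] where the lowest homogeneous part of [p], of degree d, does not vanish. On an arc t
    R(t) with R(0) = x, [p] is t^d times a polynomial in t with nonzero constant term. *)
Lemma lowest_form_detects (K : closedFieldType) N (p : {mpoly K[N]}) : p != 0 ->
  exists x : 'I_N -> K, forall R : 'I_N -> {poly K}, (forall k, (R k).[0] = x k) ->
    exists t, p.@[fun k => t * (R k).[t]] != 0.
Proof.
move=> p0.
have exd : exists d, has (fun s => mdeg s == d) (msupp p).
  exists (mdeg (mlead p)); apply/hasP; exists (mlead p) => //; exact: mlead_supp.
have [d /hasP [s0 s0p /eqP ds0] dmin] := ex_minnP exd.
have le_d s : s \in msupp p -> (d <= mdeg s)%N.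
  by move=> sp; apply: dmin; apply/hasP; exists s.
have q0 : pihomog mdeg d p != 0.
  apply/eqP => /(congr1 (mcoeff s0)); rewrite mcoeff_pihomog ds0 eqxx mcoeff0.
  by apply/eqP; rewrite -mcoeff_msupp.
have [x qx] : exists x, (pihomog mdeg d p).@[x] != 0.
  apply: NNPP => H; case/negP: q0; apply/eqP/mpoly_eval_eq0 => x.
  by apply/eqP/negPn/negP => qx; apply: H; exists x.
exists x => R Rx.
pose W := \sum_(s <- msupp p) (p@_s)%:P * 'X^(mdeg s - d) * \prod_i (R i) ^+ s i.
have W0 : W.[0] != 0.
  rewrite (_ : W.[0] = (pihomog mdeg d p).@[x]) // /W horner_sum pihomogE raddf_sum /=.
  rewrite [RHS]big_mkcond big_seq [RHS]big_seq; apply: eq_bigr => s sp.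
  rewrite !hornerM hornerC hornerXn horner_prod.
  rewrite (eq_bigr (fun i => x i ^+ s i)); last by move=> i _; rewrite horner_exp Rx.
  case: eqP => [<-|/eqP ne]; first by rewrite subnn mulr1 mevalZ mevalX.
  rewrite expr0n subn_eq0 leqNgt ltn_neqAle le_d // eq_sym ne /=.
  by rewrite mulr0 mul0r.
have XW0 : 'X^d * W != 0.
  rewrite mulf_neq0 // ?expf_neq0 ?polyX_eq0 //.
  by apply: contraNneq W0 => ->; rewrite horner0.
have [t] := closed_nonrootP _ XW0; rewrite /root hornerM hornerXn => tW.
exists t; apply: contraNneq tW => e; rewrite -e mevalE /W horner_sum mulr_sumr.
apply/eqP; rewrite big_seq [RHS]big_seq; apply: eq_bigr => s sp.
rewrite !hornerM hornerC hornerXn horner_prod.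
rewrite [in RHS](eq_bigr (fun i => t ^+ s i * (R i).[t] ^+ s i)); last first.
  by move=> i _; rewrite exprMn.
rewrite big_split /= -expr_sum -mdegE -{2}(subnK (le_d s sp)) exprD.
under eq_bigr do rewrite horner_exp.
ring.
Qed.

(** * Density of singular cubics modulo one coefficient *)

Section Elimination.
Variables (K : closedFieldType) (m : nat) (l : 'I_m).
Hypothesis two_neq0 : (2%:R : K) != 0.
Local Notation N := (dimU m).

Lemma cube_monP : exists s : cubic_mon m, (val s : 'X_{1..m}) = (U_(l) *+ 3)%MM.
Proof. by have [|s ->] := @cubic_monP m (U_(l) *+ 3)%MM; [rewrite mdegMn mdeg1 | exists s]. Qed.

(** For [i = l] this is the cube, so these are exactly the monomials whose coefficients
    [singular_at_point] kills. *)
Definition flex_mon (i : 'I_m) : 'X_{1..m} := (U_(i) + U_(l) *+ 2)%MM.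

Lemma flex_monP (s : cubic_mon m) : (1 < (val s : 'X_{1..m}) l)%N ->
  exists i, (val s : 'X_{1..m}) = flex_mon i.
Proof.
move=> ls; set a := (val s : 'X_{1..m}) in ls *.
have d3 : mdeg a = 3 by apply/eqP; exact: (valP s).
have le : (U_(l) *+ 2 <= a)%MM.
  apply/mnm_lepP => i; rewrite mulmnE mnm1E; case: eqP => [<-|] //=.
have : mdeg (a - U_(l) *+ 2)%MM = 1%N.
  apply/eqP; rewrite -(eqn_add2r (mdeg (U_(l) *+ 2)%MM)) -mdegD submK //.
  by rewrite d3 mdegMn mdeg1.
move/eqP/mdeg1P => [i /eqP e]; exists i.
by rewrite /flex_mon -e submK.
Qed.

Lemma eval_line_act (Y : 'M[K]_m) (x : 'I_N -> K) k :
  exists R : {poly K}, R.[0] = x k /\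
    forall t, actU (1%:M + t *: Y) x k = R.[t].
Proof.
have fC := poly_fun_algebra K.
have [R RP] : is_poly_fun (fun t => actU (1%:M + t *: Y) x k).
  apply: (fa_act fC (g := fun t => 1%:M + t *: Y) (x := fun => x)) => [i j|j].
    by exists ((1%:M i j)%:P + 'X * (Y i j)%:P) => t; rewrite !hornerE !mxE.
  exact: (fa_const fC).
by exists R; split=> [|t] //; rewrite RP scale0r addr0 actU1.
Qed.

Lemma cubD (x y : 'I_N -> K) (t : K) (i : 'I_3) :
  cub (fun k => x k + t * y k) i = cub x i + t *: cub y i.
Proof.
rewrite /cub /cubic_form scaler_sumr -big_split /=; apply: eq_bigr => s _.
by rewrite scalerDl scalerA.
Qed.

Lemma actUD g (x y : 'I_N -> K) (t : K) k :
  actU g (fun k => x k + t * y k) k = actU g x k + t * actU g y k.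
Proof.
move: k; apply: eq_cub => i.
by rewrite cubD !cub_act cubD comp_mpolyD comp_mpolyZ.
Qed.

(** Substituting [1%:M + t *: shear y] fixes the variable [l]; in the chart where that variable is
    1, it translates the other coordinates by [t * y i]. *)
Definition shear (y : 'I_m -> K) : 'M[K]_m :=
  \matrix_(i, j) (if (j == l) && (i != l) then y i else 0).

Lemma shear_substX (y : 'I_m -> K) (t : K) i : i != l ->
  'X_i \mPo lin_subst (1%:M + t *: shear y) = 'X_i + (t * y i) *: 'X_l.
Proof.
move=> il; rewrite comp_lin_substX.
under eq_bigr do rewrite !mxE scalerDl.
rewrite big_split /=; congr (_ + _).
  rewrite (bigD1 i) //= eqxx scale1r big1 ?addr0 // => j ji.
  by rewrite eq_sym (negPf ji) scale0r.
rewrite (bigD1 l) //= eqxx il big1 ?addr0 // => j jl.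
by rewrite (negPf jl) /= mulr0 scale0r.
Qed.

Lemma shear_substXl (y : 'I_m -> K) (t : K) :
  'X_l \mPo lin_subst (1%:M + t *: shear y) = 'X_l.
Proof.
rewrite comp_lin_substX (bigD1 l) //= !mxE !eqxx /= mulr0 addr0 scale1r.
rewrite big1 ?addr0 // => j jl.
by rewrite !mxE eqxx andbF mulr0 addr0 eq_sym (negPf jl) scale0r.
Qed.

(** In the chart where the variable [l] is 1, this is the sum of the squares of the others. As 2 is
    invertible, its translates have arbitrary linear terms. *)
Definition node_cubic : {mpoly K[m]} := \sum_(i | i != l) 'X_i ^+ 2 * 'X_l.

Lemma node_cubic_shear (y : 'I_m -> K) (t : K) :
  node_cubic \mPo lin_subst (1%:M + t *: shear y) =
  node_cubic + t *: (\sum_(i | i != l) (2 * y i) *: 'X_[flex_mon i])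
    + (\sum_(i | i != l) (t * y i) ^+ 2) *: 'X_[U_(l) *+ 3].
Proof.
rewrite /node_cubic raddf_sum /= scaler_sumr scaler_suml -!big_split /=.
apply: eq_bigr => i il.
rewrite rmorphM rmorphXn /= shear_substX // shear_substXl.
rewrite /flex_mon mpolyXD -!mpolyXn -!mul_mpolyC expr2 !mpolyCM mpolyC_nat; ring.
Qed.

(* Shearing [node_cubic + t x'] by [1 + t Y] reaches [node_cubic + t x + O(t^2)] for
   every [x], up to the coefficient of ['X_l ^+ 3]: the linear term of
   [node_cubic_shear] supplies the coefficients of ['X_l ^+ 2 * 'X_i].  The lowest
   homogeneous part of [Q] at [node_cubic] therefore vanishes. *)
Lemma singular_ideal_eliminate (c0 : cubic_mon m) (Q : {mpoly K[N]}) :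
  (val c0 : 'X_{1..m}) = (U_(l) *+ 3)%MM ->
  (forall x y : 'I_N -> K,
     (forall k, k != enum_rank (ord0, c0) -> x k = y k) -> Q.@[x] = Q.@[y]) ->
  singular_ideal l Q -> Q = 0.
Proof.
move=> ec0 indep IQ; apply/eqP/negPn/negP => Q0.
have homs (i : 'I_3) : (if i == ord0 then node_cubic else 0) \is 3.-homog.
  case: ifP => _; last exact: dhomog0.
  apply: rpred_sum => j _; rewrite mpolyXn -mpolyXD dhomogX.
  have d3 : mdeg (U_(j) *+ 2 + U_(l))%MM = 3%N by rewrite mdegD mdegMn !mdeg1.
  exact/eqP/d3.
have [xs xsP] := exists_cub homs.
(* Move the node cubic to the origin, where the lowest homogeneous part is taken. *)
pose Q' := Q \mPo [tuple 'X_k + (xs k)%:MP | k < N].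
have Q'E z : Q'.@[z] = Q.@[fun k => xs k + z k].
  rewrite /Q' comp_mpoly_meval; apply: meval_eq => k.
  by rewrite tnth_mktuple mevalD mevalXU mevalC addrC.
have Q'0 : Q' != 0.
  apply: contraNneq Q0 => e; apply/eqP/mpoly_eval_eq0 => x.
  have := Q'E (fun k => x k - xs k); rewrite e meval0 => ->.
  by apply: meval_eq => k; rewrite addrC subrK.
have [x xP] := lowest_form_detects Q'0.
pose bad (k : 'I_N) := let c : coordU m := enum_val k in
  (c.1 == ord0) && (1 < (val c.2 : 'X_{1..m}) l)%N.
(* Only the part of [x] allowed by [singular_at_point] is added to the node; the shear recovers the
   rest. *)
pose x' k := if bad k then 0 else x k.
have x'P : singular_at_point l x'.
  by move=> s ls; rewrite /x' /bad enum_rankK /= ls.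
(* The division by 2 offsets the factor 2 in the linear term of [node_cubic_shear]. *)
pose y i := (cub x ord0)@_(flex_mon i) / 2%:R.
pose g t := 1%:M + t *: shear y.
have [R RP] : exists R : 'I_N -> {poly K}, forall k, (R k).[0] = x k /\
    (k != enum_rank (ord0, c0) -> forall t,
       actU (g t) (fun k => xs k + t * x' k) k = xs k + t * (R k).[t]).
  have [S SP] : exists S : 'I_N -> {poly K}, forall k, (S k).[0] = x' k /\
      forall t, actU (g t) x' k = (S k).[t].
    apply: (fin_all_exists (P := fun k S => S.[0] = x' k /\
      forall t, actU (g t) x' k = S.[t])) => k.
    exact: eval_line_act.
  exists (fun k => S k + (x k - x' k)%:P) => k; have [S0 St] := SP k.
  split; first by rewrite hornerD hornerC S0 addrC subrK.
  move=> kc t; rewrite actUD St hornerD hornerC mulrDr addrA addrAC; congr (_ + _).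
  rewrite -[k]enum_valK in kc *; case: (enum_val k) kc => i s kc.
  rewrite -[LHS]mcoeff_cub cub_act xsP /x' /bad enum_rankK /=.
  case: (i =P ord0) kc => [->|/eqP i0] kc /=; last first.
    by rewrite raddf0 mcoeff0 -[xs _]mcoeff_cub xsP (negPf i0) mcoeff0 subrr mulr0 addr0.
  rewrite node_cubic_shear !mcoeffD !mcoeffZ mcoeffX -[xs _]mcoeff_cub xsP eqxx.
  rewrite -ec0 -bmeqP (inj_eq val_inj).
  have -> : (c0 == s) = false.
    by apply: contraNF kc => /eqP ->.
  rewrite mulr0 addr0; congr (_ + t * _); rewrite raddf_sum /=.
  case: ifP => ls; last first.
    rewrite subrr big1 // => j jl; rewrite mcoeffZ mcoeffX.
    case: eqP => [e|]; last by rewrite mulr0.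
    by move: ls; rewrite -e /flex_mon mnmDE mulmnE !mnm1E eqxx mul1n addnC.
  have [j ej] := flex_monP ls; rewrite subr0 ej.
  (* With [j = l] the monomial would be the cube, which [kc] excludes. *)
  have jl : j != l.
    apply: contraNneq kc => e; apply/eqP; congr (enum_rank (_, _)).
    by apply/val_inj/val_inj; rewrite /= ec0 ej e /flex_mon mulmS.
  rewrite (bigD1 j) //= mcoeffZ mcoeffX eqxx mulr1 big1 ?addr0.
    by rewrite /y -ej mcoeff_cub mulrC divfK.
  move=> i' /andP [_ ij]; rewrite mcoeffZ mcoeffX /flex_mon eqm_add2r eq_mnm1.
  by rewrite (negPf ij) mulr0.
have [t] := xP R (fun k => (RP k).1).
rewrite Q'E => /negP; apply; apply/eqP.
(* The arc differs from a transformed singular cubic only in the coefficient on which [Q] does not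
   depend. *)
rewrite -(IQ (g t) (fun k => xs k + t * x' k)).
  by apply: indep => k kc; rewrite (RP k).2.
move=> s ls; rewrite x'P // mulr0 addr0 -mcoeff_cub xsP eqxx /node_cubic raddf_sum /=.
rewrite big1 // => i il; rewrite mpolyXn -mpolyXD mcoeffX.
case: eqP => // e; move: ls; rewrite -e mnmDE mulmnE !mnm1E (negPf il) eqxx.
by rewrite mul0n.
Qed.

End Elimination.

(** * A Macaulay determinant *)

(** Along the line through [p], [G] is a polynomial in t whose coefficient of t^d is the value in
    question. *)
Lemma pihomog_eval_eq0 (K : closedFieldType) n d (G : {mpoly K[n]}) (p : 'I_n -> K) :
  (forall t, G.@[fun i => t * p i] = 0) -> (pihomog mdeg d G).@[p] = 0.
Proof.
move=> G0; pose W := \sum_(s <- msupp G) (G@_s * \prod_i p i ^+ s i)%:P * 'X^(mdeg s).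
have W0 : W = 0.
  apply/eqP/negPn/negP => /closed_nonrootP [t /negP]; apply; apply/rootP.
  rewrite -(G0 t) mevalE horner_sum; apply: eq_bigr => s _.
  rewrite hornerM hornerC hornerXn.
  rewrite [in RHS](eq_bigr (fun i => t ^+ s i * p i ^+ s i)); last first.
    by move=> i _; rewrite exprMn.
  by rewrite big_split /= -expr_sum -mdegE -mulrA [t ^+ _ * _]mulrC.
have := congr1 (fun q : {poly K} => q`_d) W0; rewrite coef0 coef_sum => <-.
rewrite pihomogE raddf_sum /= big_mkcond; apply: eq_bigr => s _.
rewrite coefCM coefXn eq_sym; case: eqP => _; last by rewrite mulr0.
by rewrite mulr1 mevalZ mevalX.
Qed.

(** * Singular points of transformed cubics *)

Section SingularPoints.
Variables (K : closedFieldType) (m : nat) (l : 'I_m).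
Local Notation N := (dimU m).

Lemma mdeg_gt_coord (s : 'X_{1..m}) : (s l < mdeg s)%N ->
  exists2 a, a != l & (U_(a) <= s)%MM.
Proof.
move=> lt; apply: NNPP => H; move: lt; rewrite mdegE (bigD1 l) //= big1 ?addn0 ?ltnn //.
move=> a al; apply/eqP/negPn/negP => sa; apply: H; exists a => //.
by rewrite lep1mP.
Qed.

(** The matrix [g] sends [q] to a multiple of the [l]-th coordinate point. The monomial has at least
    two factors other than the variable [l]; both become linear forms vanishing at [q], so the
    product vanishes there to second order. *)
Lemma singular_point_monomial (g : 'M[K]_m) (q : 'I_m -> K) (s : cubic_mon m) :
  (forall i, i != l -> \sum_j g i j * q j = 0) ->
  ((val s : 'X_{1..m}) l <= 1)%N ->
  let M := 'X_[val s : 'X_{1..m}] \mPo lin_subst g in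
  M.@[q] = 0 /\ forall j, (M^`M(j)).@[q] = 0.
Proof.
move=> gq sl /=; set s' := (val s : 'X_{1..m}) in sl *; set M := comp_mpoly _ _.
have d3 : mdeg s' = 3 by apply/eqP; exact: (valP s).
have L0 i : i != l -> (\sum_(j < m) g i j *: 'X_j : {mpoly K[m]}).@[q] = 0.
  move=> il; rewrite raddf_sum /= -[RHS](gq _ il); apply: eq_bigr => j _.
  by rewrite mevalZ mevalXU.
have [a al sa] : exists2 a, a != l & (U_(a) <= s')%MM.
  by apply: mdeg_gt_coord; rewrite d3; apply: leq_ltn_trans sl _.
have d2 : mdeg (s' - U_(a))%MM = 2.
  by apply/eqP; rewrite -(eqn_add2r (mdeg U_(a)%MM)) -mdegD submK // d3 mdeg1.
have [b bl sb] : exists2 b, b != l & (U_(b) <= s' - U_(a))%MM.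
  apply: mdeg_gt_coord; rewrite d2 ltnS.
  by rewrite mnmBE; apply: leq_trans (leq_subr _ _) sl.
have eM : M = (\sum_(j < m) g a j *: 'X_j) *
    ((\sum_(j < m) g b j *: 'X_j) * ('X_[s' - U_(a) - U_(b)] \mPo lin_subst g)).
  have -> : M = 'X_[U_(a) + (U_(b) + (s' - U_(a) - U_(b)))] \mPo lin_subst g.
    by rewrite [(U_(b) + _)%MM]addmC submK // addmC submK.
  by rewrite !mpolyXD !rmorphM /= !comp_lin_substX.
split; first by rewrite eM mevalM L0 // mul0r.
by move=> j; rewrite eM !mderivM mevalD !mevalM !mevalD !mevalM !L0 //; ring.
Qed.

Lemma singular_point_act (g : 'M[K]_m) (q : 'I_m -> K) (x : 'I_N -> K) :
  singular_at_point l x -> (forall i, i != l -> \sum_j g i j * q j = 0) ->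
  (cub (actU g x) ord0).@[q] = 0 /\ forall j, ((cub (actU g x) ord0)^`M(j)).@[q] = 0.
Proof.
move=> Lx gq; rewrite cub_act /cub /cubic_form.
rewrite (raddf_sum (comp_mpoly (lin_subst g))) /=.
have H s := @singular_point_monomial g q s gq.
split=> [|j].
  rewrite (raddf_sum (meval q)) big1 //= => s _; rewrite comp_mpolyZ mevalZ.
  case: (leqP ((val s : 'X_{1..m}) l) 1) => [/H [-> _]|/Lx ->].
    by rewrite mulr0.
  by rewrite mul0r.
rewrite (raddf_sum (mderiv j)) (raddf_sum (meval q)) big1 //= => s _.
rewrite comp_mpolyZ mderivZ mevalZ.
case: (leqP ((val s : 'X_{1..m}) l) 1) => [/H [_ ->]|/Lx ->].
  by rewrite mulr0.
by rewrite mul0r.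
Qed.

(** Invertible matrices are dense: on the line t + [g], the value of [P] times the characteristic
    polynomial of [- g] vanishes for all t, and the latter is monic. *)
Lemma singular_ideal_inv (P : {mpoly K[N]}) :
  (forall g x, g \in unitmx -> singular_at_point l x -> P.@[actU g x] = 0) ->
  singular_ideal l P.
Proof.
move=> H g x Lx; have fC := poly_fun_algebra K.
have [r rP] : is_poly_fun (fun t => P.@[actU (t%:M - - g) x]).
  apply: (fa_meval fC); apply: (fa_act fC (g := fun t => t%:M - - g) (x := fun=> x)) => [i j|k].
    exists ('X *+ (i == j) + (g i j)%:P) => t.
    by rewrite hornerD hornerMn hornerX hornerC !mxE opprK.
  exact: (fa_const fC).
have detE t : (char_poly (- g)).[t] = \det (t%:M - - g).
  rewrite -[LHS]/(horner_eval t _) -det_map_mx; congr (\det _).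
  apply/matrixP => i j; rewrite !mxE /=.
  by rewrite horner_evalE hornerD hornerN hornerMn hornerX hornerC.
have r0 : r = 0.
  have : r * char_poly (- g) = 0.
    apply/eqP/negPn/negP => /closed_nonrootP [t /negP]; apply; apply/rootP.
    rewrite hornerM rP detE; have [->|d0] := eqVneq (\det (t%:M - - g)) 0.
      by rewrite mulr0.
    by rewrite H ?mul0r // unitmxE unitfE.
  move/eqP; rewrite mulf_eq0 => /orP [/eqP //|].
  by rewrite (negPf (monic_neq0 (char_poly_monic _))).
by have := rP 0; rewrite r0 horner0 opprK raddf0 add0r => <-.
Qed.

End SingularPoints.

(** * The Jacobian ideal of the chain cubic *)

Section Macaulay.
Variables (K : closedFieldType) (n : nat).
Hypothesis two_neq0 : (2%:R : K) != 0.
Local Notation m := n.+1.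
Local Notation N := (dimU m).

(* [nxt] fixes the last index, so the last term of [chain_cubic] is a cube. *)
Definition nxt (i : 'I_m) : 'I_m := inord (minn i.+1 n).

Definition chain_cubic : {mpoly K[m]} := \sum_i 'X_i ^+ 2 * 'X_(nxt i).

(** The cubic itself is a generator besides its partial derivatives: Euler's relation yields only 3
    times the cubic, which is 0 in characteristic 3. *)
Definition in_jacobian (q : {mpoly K[m]}) :=
  exists (A : 'I_m -> {mpoly K[m]}) (B : {mpoly K[m]}),
    q = \sum_i A i * chain_cubic^`M(i) + B * chain_cubic.

Definition in_radical q := exists e, in_jacobian (q ^+ e).

Lemma in_jacobianD p q : in_jacobian p -> in_jacobian q -> in_jacobian (p + q).
Proof.
move=> [A [B ->]] [A' [B' ->]]; exists (fun i => A i + A' i), (B + B').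
rewrite mulrDl addrACA -big_split /=; congr (_ + _).
by apply: eq_bigr => i _; rewrite mulrDl.
Qed.

Lemma in_jacobianM p q : in_jacobian q -> in_jacobian (p * q).
Proof.
move=> [A [B ->]]; exists (fun i => p * A i), (p * B).
rewrite mulrDr mulr_sumr mulrA; congr (_ + _).
by apply: eq_bigr => i _; rewrite mulrA.
Qed.

Lemma in_jacobian0 : in_jacobian 0.
Proof. by exists (fun=> 0), 0; rewrite mul0r addr0 big1 // => i _; rewrite mul0r. Qed.

Lemma in_jacobian_deriv i : in_jacobian chain_cubic^`M(i).
Proof.
exists (fun j => (j == i)%:R), 0; rewrite mul0r addr0 (bigD1 i) //= eqxx mul1r.
by rewrite big1 ?addr0 // => j /negPf ->; rewrite mul0r.
Qed.

Lemma in_jacobian_cubic : in_jacobian chain_cubic.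
Proof.
by exists (fun=> 0), 1; rewrite mul1r big1 ?add0r // => i _; rewrite mul0r.
Qed.

Lemma in_jacobian_radical q : in_jacobian q -> in_radical q.
Proof. by move=> Jq; exists 1%N. Qed.

Lemma in_radicalM p q : in_radical q -> in_radical (p * q).
Proof. by move=> [e Je]; exists e; rewrite exprMn; apply: in_jacobianM. Qed.

Lemma in_radicalX q k : in_radical (q ^+ k) -> in_radical q.
Proof. by move=> [e Je]; exists (k * e)%N; rewrite exprM. Qed.

Lemma in_radicalD p q : in_radical p -> in_radical q -> in_radical (p + q).
Proof.
move=> [d Jd] [e Je]; exists (d + e)%N; rewrite exprDn.
apply: (big_ind in_jacobian in_jacobian0 in_jacobianD) => i _.
rewrite -mulr_natl; apply: in_jacobianM.
case: (leqP e i) => ei.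
  by rewrite -(subnK ei) exprD !mulrA; apply: in_jacobianM.
have di : (d <= d + e - i)%N by rewrite -addnBA ?leq_addr // ltnW.
rewrite -(subnK di) exprD -mulrA; apply: in_jacobianM; rewrite mulrC.
exact: in_jacobianM.
Qed.

Lemma in_radical_sum (r : seq 'I_m) (P : pred 'I_m) F :
  (forall i, P i -> in_radical (F i)) -> in_radical (\sum_(i <- r | P i) F i).
Proof.
move=> H; apply: (big_ind in_radical) => //; last exact: in_radicalD.
by apply: in_jacobian_radical; apply: in_jacobian0.
Qed.

Lemma val_nxt (i : 'I_m) : nxt i = minn i.+1 n :> nat.
Proof. by rewrite inordK // ltnS geq_minr. Qed.

(** At the last index, which [nxt] fixes, the sum contains the square of the variable itself, and
    the total coefficient of that square is 3. *)
Lemma chain_cubic_deriv j : chain_cubic^`M(j) =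
  2%:R * 'X_j * 'X_(nxt j) + \sum_(i | nxt i == j) 'X_i ^+ 2.
Proof.
have dX (i : 'I_m) : ('X_i : {mpoly K[m]})^`M(j) = (i == j)%:R.
  rewrite mderivX mnm1E; case: eqP => [->|_]; last by rewrite scale0r.
  rewrite scale1r (_ : (U_(j) - U_(j) = 0)%MM) ?mpolyX0 //.
  by apply/mnmP => k; rewrite mnmBE subnn mnm0E.
rewrite /chain_cubic raddf_sum /= [X in _ + X]big_mkcond (bigD1 j) //=.
rewrite [in RHS](bigD1 j) //= addrA; congr (_ + _).
  by rewrite expr2 !mderivM !dX eqxx; case: eqP => _; rewrite ?mulr1n ?mulr0n; ring.
apply: eq_bigr => i ij; rewrite expr2 !mderivM !dX (negPf ij).
by case: eqP => _; rewrite ?mulr1n ?mulr0n; ring.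
Qed.

(** The only repeated value of [nxt] is the last index, the image of itself and of its
    predecessor. *)
Lemma nxt_fiber (i k : 'I_m) : (i < n)%N -> nxt k = nxt i -> k = i \/ k = nxt i.
Proof.
move=> lin /(congr1 val) /=; rewrite !val_nxt (minn_idPl lin) => e.
case: (ltnP k n) => kn.
  by left; apply/val_inj; move: e; rewrite (minn_idPl kn) => -[].
right; apply/val_inj; rewrite /= val_nxt (minn_idPl lin) -e.
rewrite (minn_idPr _) ?(leq_trans kn) //; apply/eqP.
by rewrite eqn_leq kn -ltnS ltn_ord.
Qed.

(** Modulo earlier variables the derivative at [i] is twice the product of the variables [i] and
    [nxt i], so this product lies in the radical. The variable [i] times the derivative at [nxt i]
    is its cube plus a multiple of that product. *)
Lemma in_radicalX_chain_step (i : 'I_m) : (i < n)%N ->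
  (forall k : 'I_m, (k < i)%N -> in_radical 'X_k) -> in_radical 'X_i.
Proof.
move=> lin IH.
have vn : nxt i = i.+1 :> nat by rewrite val_nxt; apply/minn_idPl.
have rXX : in_radical ('X_i * 'X_(nxt i)).
  have -> : 'X_i * 'X_(nxt i) = (2%:R^-1)%:MP * (chain_cubic^`M(i) +
      (-1) * \sum_(k | nxt k == i) 'X_k ^+ 2).
    rewrite chain_cubic_deriv mulN1r addrK.
    transitivity ((2%:R^-1 * 2%:R)%:MP * ('X_i * 'X_(nxt i)) : {mpoly K[m]}).
      by rewrite mulVf // mpolyC1 mul1r.
    by rewrite mpolyCM mpolyC_nat; ring.
  apply: in_radicalM; apply: in_radicalD.
    by apply: in_jacobian_radical; apply: in_jacobian_deriv.
  apply: in_radicalM; apply: in_radical_sum => k /eqP ek.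
  rewrite expr2; apply: in_radicalM; apply: IH.
  move: (congr1 val ek); rewrite /= val_nxt => ek'.
  move: lin; rewrite -ek' => lt; rewrite leq_min leqnn /=.
  by rewrite gtn_min ltnn orbF in lt; apply: ltnW.
apply: (@in_radicalX _ 3).
(* The conditional term is the extra square in the derivative at the last index. *)
pose Z : {mpoly K[m]} := 2%:R * 'X_(nxt (nxt i)) + (if nxt (nxt i) == nxt i then 'X_(nxt i) else 0).
have -> : 'X_i ^+ 3 = 'X_i * chain_cubic^`M(nxt i) + - Z * ('X_i * 'X_(nxt i)) :> {mpoly K[m]}.
  rewrite chain_cubic_deriv (bigD1 i) //= /Z.
  case: eqP => [e|ne].
    rewrite (bigD1 (nxt i)) /=; last by rewrite e eqxx -val_eqE /= vn gtn_eqF.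
    rewrite big1 ?addr0; first by ring.
    move=> k /andP [/andP [/eqP ek ki] kn]; case: (nxt_fiber lin ek) => ek'.
      by rewrite ek' eqxx in ki.
    by rewrite ek' eqxx in kn.
  rewrite big1 ?addr0; first by ring.
  move=> k /andP [/eqP ek ki]; case: (nxt_fiber lin ek) => ek'.
    by rewrite ek' eqxx in ki.
  by case: ne; move: ek; rewrite ek'.
apply: in_radicalD; last exact: in_radicalM.
by apply: in_radicalM; apply: in_jacobian_radical; apply: in_jacobian_deriv.
Qed.

(** The chain step gives all variables but the last, whose cube is the chain cubic minus terms
    divisible by earlier variables. *)
Lemma in_radical_var (i : 'I_m) : in_radical 'X_i.
Proof.
have lt i' : (i' < n)%N -> in_radical 'X_(inord i').
  elim/ltn_ind: i' => k IH kn; apply: in_radicalX_chain_step.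
    by rewrite inordK // ltnW.
  move=> j; rewrite inordK; last exact: ltnW.
  by move=> jk; rewrite -[j]inord_val; apply: IH => //; apply: ltn_trans kn.
case: (ltnP i n) => [/lt|ge]; first by rewrite inord_val.
have ei : i = ord_max.
  by apply/val_inj/eqP; rewrite /= eqn_leq ge -ltnS ltn_ord.
apply: (@in_radicalX _ 3).
have -> : 'X_i ^+ 3 = chain_cubic + (-1) * \sum_(k | k != i) 'X_k ^+ 2 * 'X_(nxt k).
  have en : nxt i = i by apply/val_inj; rewrite /= val_nxt ei /=; apply/minn_idPr.
  by rewrite /chain_cubic (bigD1 i) //= en; ring.
apply: in_radicalD; first by apply: in_jacobian_radical; apply: in_jacobian_cubic.
apply: in_radicalM; apply: in_radical_sum => k ki.
rewrite mulrC; apply: in_radicalM; rewrite expr2; apply: in_radicalM.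
rewrite -[k]inord_val; apply: lt; rewrite ltn_neqAle -ltnS ltn_ord andbT.
by apply: contra ki => /eqP e; rewrite ei -val_eqE /= e.
Qed.

Lemma monomials_in_jacobian : exists k, forall a : 'X_{1..m}, mdeg a = k ->
  in_jacobian 'X_[a].
Proof.
have [e eP] : exists e : 'I_m -> nat, forall i, in_jacobian ('X_i ^+ e i).
  apply: (fin_all_exists (P := fun i e => in_jacobian ('X_i ^+ e))) => i.
  exact: in_radical_var.
(* A degree above the sum of the [e i] forces some exponent [a i] to reach [e i]. *)
exists (\sum_i e i).+1 => a da.
have [i ei] : exists i, (e i <= a i)%N.
  apply: NNPP => H; suff : (mdeg a <= \sum_i e i)%N by rewrite da ltnn.
  rewrite mdegE; apply: leq_sum => i _; rewrite leqNgt; apply/negP => lt.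
  by apply: H; exists i; apply: ltnW.
have ea : (U_(i) *+ e i <= a)%MM.
  by apply/mnm_lepP => j; rewrite mulmnE mnm1E; case: eqP => [<-|] //=; rewrite mul1n.
rewrite -(submK ea) mpolyXD -mpolyXn; apply: in_jacobianM; exact: eP.
Qed.

(* Every monomial of degree [k] is a combination of [chain_cubic] and its partial
   derivatives.  [P] is the determinant, over these monomials, of the same
   combinations formed from a variable cubic: it is 1 at [chain_cubic], and at a
   cubic singular in [q] the monomials evaluated at [q] give a kernel vector. *)
Lemma macaulay_determinant (x0 : 'I_N -> K) (l : 'I_m) :
  cub x0 ord0 = chain_cubic ->
  exists2 P, singular_ideal l P & P.@[x0] != 0.
Proof.
move=> ex0; have [k kP] := monomials_in_jacobian.
pose T : finType := 'X_{1..m < k.+1}.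
have [AB ABP] : exists AB : T -> ('I_m -> {mpoly K[m]}) * {mpoly K[m]},
    forall a : T, mdeg (val a) = k -> 'X_[val a] =
      \sum_i (AB a).1 i * chain_cubic^`M(i) + (AB a).2 * chain_cubic.
  apply: (fin_all_exists (P := fun a AB => mdeg (val a) = k -> 'X_[val a] =
      \sum_i AB.1 i * chain_cubic^`M(i) + AB.2 * chain_cubic)) => a.
  case: (eqVneq (mdeg (val a)) k) => [/kP [A [B e]]|ne].
    by exists (A, B).
  by exists (fun=> 0, 0) => e; rewrite e eqxx in ne.
pose G (x : 'I_N -> K) (a : T) : {mpoly K[m]} :=
  \sum_i (AB a).1 i * (cub x ord0)^`M(i) + (AB a).2 * cub x ord0.
(* Rows of degree other than [k] are those of the identity, so only the block of degree [k] counts.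
   The homogeneous part is taken because the multipliers [AB] may be inhomogeneous. *)
pose Mx x (a c : T) : K :=
  if mdeg (val a) == k then (pihomog mdeg k (G x a))@_(val c) else (a == c)%:R.
pose M x : 'M[K]_#|T| := \matrix_(i, j) Mx x (enum_val i) (enum_val j).
have fC := mpoly_fun_algebra K N.
have [P PE] : is_mpoly_fun (fun x => \det (M x)).
  apply: (fa_det fC) => i j; apply: (fa_ext fC (F := fun x => Mx x (enum_val i) (enum_val j))).
    by move=> x; rewrite mxE.
  have cubC : fa_coef (@is_mpoly_fun K N) (fun x => cub x ord0).
    apply: (fa_coef_sum fC) => s _; apply: (fa_coefZ fC); last exact: fa_coef_const.
    by exists 'X_(enum_rank (ord0, s)) => x; rewrite mevalXU.
  have dcubC u : fa_coef (@is_mpoly_fun K N) (fun x => (cub x ord0)^`M(u)).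
    move=> s; apply: (fa_ext fC (F := fun x => (cub x ord0)@_(s + U_(u)) * (s u).+1%:R)).
      by move=> x; rewrite mcoeff_mderiv mulr_natr.
    by apply: (fa_mul fC) (cubC _) (fa_const fC _).
  have GC a : fa_coef (@is_mpoly_fun K N) (fun x => G x a).
    move=> s; apply: (fa_ext fC (F := fun x =>
        (\sum_i (AB a).1 i * (cub x ord0)^`M(i))@_s + ((AB a).2 * cub x ord0)@_s)).
      by move=> x; rewrite -mcoeffD.
    apply: (fa_add fC); last exact: (fa_coefM fC (fa_coef_const fC _)).
    by apply: (fa_coef_sum fC) => u _; apply: (fa_coefM fC (fa_coef_const fC _)).
  rewrite /Mx; set b := mdeg _ == k; case: b; last exact: (fa_const fC).
  set c := enum_val j; apply: (fa_ext fC (F := fun x =>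
     if mdeg (val c) == k then (G x (enum_val i))@_(val c) else 0)).
    by move=> x; rewrite mcoeff_pihomog.
  case: (mdeg (val c) == k); [exact: GC | exact: (fa_const fC)].
exists P.
  apply: singular_ideal_inv => g x gu Lx; rewrite PE -det_tr; apply/eqP/det0P.
  (* [g] sends this column of its inverse to the [l]-th coordinate vector, so the transformed cubic
     is singular at [q]. *)
  pose q j := invmx g j l.
  have gq i : \sum_j g i j * q j = (i == l)%:R.
    have := congr1 (fun A : 'M[K]_m => A i l) (mulmxV gu).
    by rewrite !mxE => <-; apply: eq_bigr => j _.
  have [j qj] : exists j, q j != 0.
    apply: NNPP => H; have := gq l; rewrite eqxx big1 => [/esym/eqP|j _].
      by rewrite oner_eq0.
    by have [->|qj] := eqVneq (q j) 0; [rewrite mulr0 | case: H; exists j].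
  pose v : 'rV[K]_#|T| := \row_i (if mdeg (val (enum_val i)) == k then
    \prod_j q j ^+ (val (enum_val i) : 'X_{1..m}) j else 0).
  exists v.
    have dk : (mdeg (U_(j) *+ k)%MM < k.+1)%N by rewrite mdegMn mdeg1 mul1n.
    apply/negP => /eqP/rowP/(_ (enum_rank (BMultinom dk))); rewrite !mxE enum_rankK /=.
    rewrite mdegMn mdeg1 mul1n eqxx => /eqP; apply/negP.
    rewrite prodf_seq_neq0; apply/allP => i _ /=; rewrite mulmnE mnm1E.
    have [<-|_] := eqVneq j i; first by rewrite mul1n expf_neq0.
    by rewrite mul0n expr0 oner_neq0.
  apply/rowP => i; rewrite !mxE.
  have [di|di] := eqVneq (mdeg (val (enum_val i))) k; last first.
    rewrite (bigD1 i) //= big1 => [|u ui]; rewrite !mxE /Mx (negPf di).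
      by rewrite mul0r addr0.
    rewrite (inj_eq enum_val_inj); move: ui; rewrite eq_sym => /negPf ->.
    by rewrite mulr0.
  have e0 : (pihomog mdeg k (G (actU g x) (enum_val i))).@[q] = 0.
    (* The transformed cubic is singular along the whole line through [q], so the full combination
       vanishes on that line. *)
    apply: pihomog_eval_eq0 => t.
    have [|F0 dF0] := @singular_point_act _ _ l g (fun j => t * q j) x Lx.
      move=> u ul; under eq_bigr do rewrite mulrCA.
      by rewrite -mulr_sumr gq (negPf ul) mulr0.
    rewrite /G mevalD mevalM F0 mulr0 addr0 raddf_sum big1 //= => u _.
    by rewrite mevalM dF0 mulr0.
  have szk : (msize (pihomog mdeg k (G (actU g x) (enum_val i))) <= k.+1)%N.
    apply/bigmax_leqP_seq => s sG _; rewrite ltnS.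
    by have /dhomogP/(_ _ sG) -> := pihomogP mdeg k (G (actU g x) (enum_val i)).
  rewrite -[RHS]e0 (mpolywE szk) raddf_sum /=.
  rewrite [RHS](reindex (enum_val : 'I_#|T| -> T)) /=; last first.
    by exists enum_rank => u _; rewrite ?enum_valK ?enum_rankK.
  apply: eq_bigr => u _; rewrite !mxE /Mx di eqxx mevalZ mevalX mulrC.
  have [//|ne] := eqVneq (mdeg (val (enum_val u))) k.
  by rewrite mulr0 [X in X * _]mcoeff_pihomog (negPf ne) mul0r.
rewrite PE (_ : M x0 = 1%:M) ?det1 ?oner_neq0 //.
apply/matrixP => i j; rewrite !mxE /Mx.
have [di|di] := eqVneq (mdeg (val (enum_val i))) k.
  rewrite /G ex0 -ABP // pihomog_dE ?dhomogX ?mcoeffX; last exact/eqP/di.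
  by rewrite -bmeqP (inj_eq enum_val_inj).
by rewrite (inj_eq enum_val_inj).
Qed.

End Macaulay.

(** * The discriminant *)

Section MultiplicativeFunction.
Variables (K : closedFieldType) (n : nat).
Local Notation m := n.+1.
Variable chi : 'M[K]_m -> K.
Hypotheses (chi1 : chi 1%:M = 1)
  (chiM : forall g h, g \in unitmx -> h \in unitmx -> chi (g *m h) = chi g * chi h)
  (chi_poly : forall A B, is_poly_fun (fun t => chi (A + t *: B))).

Lemma chi_neq0 g : g \in unitmx -> chi g != 0.
Proof.
move=> gu; have : chi g * chi (invmx g) != 0.
  by rewrite -chiM ?unitmx_inv // mulmxV // chi1 oner_eq0.
by rewrite mulf_eq0 negb_or => /andP [].
Qed.

(* [t |-> chi (1 + t A)] is a polynomial without zeros, hence constant. *)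
Lemma chi_unipotent A : (forall t, 1%:M + t *: A \in unitmx) -> chi (1%:M + A) = 1.
Proof.
move=> uA; have [p pE] := chi_poly 1%:M A.
have sz1 : size p = 1%N.
  apply/eqP/negPn/negP => /closed_rootP [t /rootP]; rewrite pE => /eqP.
  by apply/negP/chi_neq0.
have [c ec] : exists c, p = c%:P by exists p`_0; apply: size1_polyC; rewrite sz1.
have p0 := pE 0; have p1 := pE 1; move: p0 p1; rewrite ec !hornerC.
by rewrite scale0r addr0 chi1 scale1r => -> <-.
Qed.

Lemma chi_lower (L : 'M[K]_m) : (forall i j : 'I_m, (i <= j)%N -> L i j = (i == j)%:R) -> chi L = 1.
Proof.
move=> LP; rewrite -[L](subrK 1%:M) addrC; apply: chi_unipotent => t.
rewrite unitmxE det_trig ?big1 ?unitr1 // => [i _|].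
  by rewrite !mxE LP // eqxx subrr mulr0 addr0.
apply/is_trig_mxP => i j ij; rewrite !mxE LP ?(ltnW ij) // -val_eqE.
by rewrite (ltn_eqF ij) subrr mulr0 addr0.
Qed.

Lemma chi_upper (U : 'M[K]_m) : (forall i j : 'I_m, (j <= i)%N -> U i j = (i == j)%:R) -> chi U = 1.
Proof.
move=> UP; rewrite -[U](subrK 1%:M) addrC; apply: chi_unipotent => t.
rewrite unitmxE -det_tr det_trig ?big1 ?unitr1 // => [i _|].
  by rewrite !mxE UP // eqxx subrr mulr0 addr0.
apply/is_trig_mxP => i j ij; rewrite !mxE UP ?(ltnW ij) // -val_eqE.
by rewrite (gtn_eqF ij) subrr mulr0 addr0.
Qed.

Definition dilation (i : 'I_m) (c : K) : 'M[K]_m :=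
  diag_mx (\row_j if j == i then c else 1).

Lemma dilation_unit i c : c != 0 -> dilation i c \in unitmx.
Proof.
move=> c0; rewrite unitmxE det_diag unitfE prodf_seq_neq0; apply/allP => j _ /=.
by rewrite mxE; case: ifP; rewrite ?c0 ?oner_neq0.
Qed.

Lemma dilationM i c d : dilation i (c * d) = dilation i c *m dilation i d.
Proof.
rewrite /dilation mulmx_diag; congr diag_mx; apply/rowP => j; rewrite !mxE.
by case: ifP; rewrite ?mulr1.
Qed.

Lemma dilation1 i : dilation i 1 = 1%:M.
Proof.
apply/matrixP => j k; rewrite !mxE; case: ifP => //.
Qed.

Lemma perm_mx_unit (s : {perm 'I_m}) : perm_mx s \in @unitmx K m.
Proof. exact: unitmx_perm. Qed.

Lemma chi_dilation i c : c != 0 -> chi (dilation i c) = chi (dilation ord0 c).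
Proof.
move=> c0; pose s := tperm ord0 i.
have -> : dilation i c = perm_mx s *m dilation ord0 c *m perm_mx s^-1.
  rewrite -row_permE -col_permE; apply/matrixP => j k; rewrite !mxE.
  rewrite (inj_eq perm_inj); case: (j == k) => //.
  rewrite (_ : (s j == ord0) = (j == i)) //.
  by rewrite -[in RHS](inj_eq (@perm_inj _ s)) /s tpermR.
rewrite !chiM ?unitmx_mul ?perm_mx_unit ?dilation_unit //.
rewrite mulrAC -chiM ?perm_mx_unit // -perm_mxM mulgV perm_mx1 chi1.
by rewrite mul1r.
Qed.

Lemma chi_diag (d : 'rV[K]_m) : (forall i, d 0 i != 0) ->
  chi (diag_mx d) = chi (dilation ord0 (\prod_i d 0 i)).
Proof.
move=> d0.
have H (r : seq 'I_m) : chi (diag_mx (\row_j \prod_(i <- r) (if j == i then d 0 i else 1))) =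
    chi (dilation ord0 (\prod_(i <- r) d 0 i)).
  elim: r => [|i r IH].
    rewrite big_nil dilation1; congr chi; apply/matrixP => j k.
    by rewrite !mxE big_nil.
  have -> : diag_mx (\row_j \prod_(k <- i :: r) (if j == k then d 0 k else 1)) =
     dilation i (d 0 i) *m diag_mx (\row_j \prod_(k <- r) (if j == k then d 0 k else 1)).
    rewrite /dilation mulmx_diag; congr diag_mx; apply/rowP => j.
    by rewrite !mxE big_cons.
  rewrite chiM ?dilation_unit // ?IH ?chi_dilation //; last first.
    rewrite unitmxE det_diag unitfE prodf_seq_neq0; apply/allP => j _ /=; rewrite mxE.
    rewrite prodf_seq_neq0; apply/allP => k _ /=; case: ifP => _ //.
    exact: oner_neq0.
  rewrite big_cons dilationM chiM ?dilation_unit //.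
  by rewrite prodf_seq_neq0; apply/allP => k _ /=.
rewrite -(H (index_enum 'I_m)); congr (chi (diag_mx _)); apply/rowP => j.
rewrite mxE (bigD1 j) //= eqxx big1 ?mulr1 // => k kj.
by rewrite eq_sym (negPf kj).
Qed.

(** The order of the symmetric group kills the values at permutation matrices; the factor 2 kills
    the value at a dilation by -1. *)
Definition character_exponent := (2 * #|[set: {perm 'I_m}]|)%N.

Lemma chi_perm (s : {perm 'I_m}) : chi (perm_mx s) ^+ character_exponent = 1.
Proof.
have H k : chi (perm_mx (s ^+ k)%g) = chi (perm_mx s) ^+ k.
  elim: k => [|k IH]; first by rewrite expg0 perm_mx1 chi1.
  by rewrite expgS perm_mxM chiM ?perm_mx_unit // IH exprS.
rewrite /character_exponent mulnC exprM -H.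
rewrite (_ : (s ^+ _)%g = 1%g) ?perm_mx1 ?chi1 ?expr1n //.
by apply: (@expg_cardG _ [set: {perm 'I_m}]%G); rewrite inE.
Qed.

(** Factor [U] as its diagonal times a unipotent upper triangular matrix. *)
Lemma chi_upper_triangular (U : 'M[K]_m) : U \in unitmx ->
  (forall i j : 'I_m, (j < i)%N -> U i j = 0) ->
  chi U = chi (dilation ord0 (\det U)).
Proof.
move=> uU UP.
have dU : \det U = \prod_i U i i.
  rewrite -det_tr det_trig; first by apply: eq_bigr => i _; rewrite mxE.
  by apply/is_trig_mxP => i j ij; rewrite mxE UP.
have U0 i : U i i != 0.
  move: uU; rewrite unitmxE unitfE dU prodf_seq_neq0 => /allP /(_ i).
  by rewrite mem_index_enum => /(_ isT).
pose d : 'rV[K]_m := \row_i U i i.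
pose V : 'M[K]_m := \matrix_(i, j) ((U i i)^-1 * U i j).
have eU : U = diag_mx d *m V.
  apply/matrixP => i j; by rewrite mul_diag_mx !mxE mulrA divff // mul1r.
have VP (i j : 'I_m) : (j <= i)%N -> V i j = (i == j)%:R.
  rewrite leq_eqVlt mxE => /orP [/eqP e|lt].
    by rewrite (_ : j = i) ?eqxx ?mulVf //; apply/val_inj.
  by rewrite (UP i j lt) mulr0 -val_eqE (gtn_eqF lt).
have [ud uV] : diag_mx d \in unitmx /\ V \in unitmx.
  by apply/andP; rewrite -unitmx_mul -eU.
rewrite {1}eU chiM // (chi_upper VP) mulr1 chi_diag.
  by rewrite dU; congr (chi (dilation _ _)); apply: eq_bigr => i _; rewrite mxE.
by move=> i; rewrite mxE.
Qed.

(** In [perm_mx s *m g = L *m U] the determinant of [U] is the sign of [s]. So, up to the value at a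
    permutation matrix, [chi g] is the value at a dilation by 1 or -1. *)
Lemma chi_special g : \det g = 1 -> chi g ^+ character_exponent = 1.
Proof.
move=> dg; have gu : g \in unitmx by rewrite unitmxE dg unitr1.
have := cormen_lup_perm g; have := cormen_lup_correct g.
have := @cormen_lup_lower _ _ g; have := @cormen_lup_upper _ _ g.
case: (cormen_lup g) => [[Q L] U] /= UP LP eq /is_perm_mxP [s eQ].
have LP' (i j : 'I_m) : (i <= j)%N -> L i j = (i == j)%:R by move=> ij; rewrite LP.
have uPg : perm_mx s *m g \in unitmx by rewrite unitmx_mul perm_mx_unit.
have ePg : perm_mx s *m g = L *m U by rewrite -eQ.
have [uL uU] : L \in unitmx /\ U \in unitmx by apply/andP; rewrite -unitmx_mul -ePg.
have dU : \det U = (-1) ^+ s.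
  have := congr1 determinant ePg; rewrite !det_mulmx det_perm dg mulr1.
  rewrite [\det L]det_trig ?big1 ?mul1r // => [i _|]; first by rewrite LP' ?eqxx.
  by apply/is_trig_mxP => i j ij; rewrite LP' ?(ltnW ij) // -val_eqE (ltn_eqF ij).
have := congr1 (fun A => chi A ^+ character_exponent) ePg => /=.
rewrite !chiM ?perm_mx_unit // exprMn chi_perm mul1r => ->.
rewrite (chi_lower LP') mul1r chi_upper_triangular // dU.
rewrite /character_exponent exprM expr2 -chiM ?dilation_unit ?signr_eq0 //.
by rewrite -dilationM -expr2 sqrr_sign dilation1 chi1 expr1n.
Qed.

End MultiplicativeFunction.

(** * An invariant that does not vanish at the chain cubic *)

Section Discriminant.
Variables (K : closedFieldType) (n : nat).
Hypothesis two_neq0 : (2%:R : K) != 0.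
Local Notation m := n.+1.
Local Notation N := (dimU m).

Lemma singular_ideal_generator (l : 'I_m) (x0 : 'I_N -> K) :
  cub x0 ord0 = chain_cubic K n ->
  exists2 P : {mpoly K[N]}, singular_ideal l P &
    P.@[x0] != 0 /\ forall A, singular_ideal l A -> divides P A.
Proof.
move=> ex0; have [P' IP' P'0] := macaulay_determinant two_neq0 l ex0.
have [c0 ec0] := cube_monP l.
have [|||||P IP PP] := @prime_ideal_principal K N (enum_rank (ord0, c0)) (singular_ideal l).
- exact: singular_idealD.
- exact: singular_idealM.
- exact: singular_ideal_prime.
- by move=> Q; apply: singular_ideal_eliminate.
- by exists P' => //; apply: contraNneq P'0 => ->; rewrite meval0.
exists P => //; split=> //; have [A eA] := PP _ IP'.
by apply: contraNneq P'0 => e; rewrite eA mevalM e mulr0.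
Qed.

Lemma discriminant_exists (x0 : 'I_N -> K) : cub x0 ord0 = chain_cubic K n ->
  exists Q : {mpoly K[N]}, [/\ is_invariant (@inSL K m) (@actU K m) Q,
    Q.@[x0] != 0 & Q.@[fun=> 0] = 0].
Proof.
move=> ex0; have [P IP [P0 PP]] := singular_ideal_generator (@ord_max n) ex0.
(* The formula makes sense for all matrices and is polynomial in [g]; it is normalised at [x0],
   where [P] does not vanish. *)
pose chi g := P.@[actU g x0] / P.@[x0].
have semi g x : g \in unitmx -> P.@[actU g x] = chi g * P.@[x].
  move=> gu; have [A eA] := pullback_exists g P.
  have [B eB] := pullback_exists (invmx g) P.
  have [a ea] := PP _ (singular_ideal_pullback IP eA).
  have [b eb] := PP _ (singular_ideal_pullback IP eB).
  have [b' eb'] := pullback_exists g b.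
  have Pn0 : P != 0 by apply: contraNneq P0 => ->; rewrite meval0.
  (* Transforming by [g] and back exhibits an inverse of [a], which is therefore a nonzero
     constant. *)
  have : b' * a * P = P.
    apply/eqP; rewrite -subr_eq0; apply/eqP/mpoly_eval_eq0 => z.
    rewrite mevalB -mulrA -ea mevalM eb' eA -mevalM -eb eB.
    by rewrite (meval_eq _ (actUM _ _ _)) mulmxV // (meval_eq _ (actU1 _)) subrr.
  rewrite -{2}[P]mul1r => /(mulIf Pn0) ba1.
  have [c c0 ec] : exists2 c, c != 0 & a = c%:MP.
    by apply: mpoly_unit_const; apply/unitrPr; exists b'; rewrite mulrC.
  have Pg z : P.@[actU g z] = c * P.@[z] by rewrite -eA ea ec mevalM mevalC.
  by rewrite /chi !Pg mulfK.
have chi1 : chi 1%:M = 1 by rewrite /chi (meval_eq _ (actU1 _)) divff.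
have chiM g h : g \in unitmx -> h \in unitmx -> chi (g *m h) = chi g * chi h.
  move=> gu hu; rewrite {1}/chi -(meval_eq _ (actUM _ _ _)) !semi //.
  by move: (chi g) (chi h) => a b; rewrite mulrA mulfK // mulrC.
have chi_poly A B : is_poly_fun (fun t => chi (A + t *: B)).
  have fC := poly_fun_algebra K; apply: (fa_mul fC); last exact: (fa_const fC).
  apply: (fa_meval fC); apply: (fa_act fC (g := fun t => A + t *: B) (x := fun=> x0)) => [i j|k].
    by exists ((A i j)%:P + 'X * (B i j)%:P) => t; rewrite !hornerE !mxE.
  exact: (fa_const fC).
exists (P ^+ character_exponent n); split.
- move=> g dg x; rewrite !rmorphXn /= semi; last by rewrite unitmxE dg unitr1.
  by rewrite exprMn (chi_special chi1 chiM chi_poly dg) mul1r.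
- by rewrite rmorphXn expf_neq0.
(* The zero triple satisfies [singular_at_point], so [P] vanishes there, and the exponent is
   positive. *)
- rewrite rmorphXn /= -(meval_eq _ (actU1 _)) IP // expr0n.
  rewrite /character_exponent muln_eq0 /= cards_eq0.
  by case: eqP => // /setP /(_ 1%g); rewrite !inE.
Qed.

End Discriminant.

(** * Torus weights *)

Lemma mcoeff_linear_comp_eq0 (R : idomainType) n k (p : {mpoly R[n]})
    (t : n.-tuple {mpoly R[k]}) a :
  (forall i, tnth t i \is 1.-homog) -> (msize p <= mdeg a)%N -> (p \mPo t)@_a = 0.
Proof.
move=> ht pa; rewrite (mpolyE p) (raddf_sum (comp_mpoly t)) raddf_sum /= big_seq.
rewrite big1 // => s sp; rewrite comp_mpolyZ mcoeffZ comp_mpolyX.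
have hs : \prod_(i < n) tnth t i ^+ s i \is (mdeg s).-homog.
  rewrite mdegE; apply: dhomog_bigprod => i _.
  by rewrite -{2}[s i]mul1n; apply: dhomogMn.
rewrite (dhomog_nemf_coeff hs) ?mulr0 //=.
have lt : (mdeg s < mdeg a)%N by apply: leq_trans pa; apply: msize_mdeg_lt.
by apply: contraTneq lt => /= ->; rewrite ltnn.
Qed.

Lemma mcoeff_scale_vars (R : idomainType) n (w : 'I_n -> R) (p : {mpoly R[n]}) a :
  (p \mPo [tuple w i *: 'X_i | i < n])@_a = p@_a * \prod_i w i ^+ a i.
Proof.
have e (s : 'X_{1..n}) : 'X_[s] \mPo [tuple w i *: 'X_i | i < n] =
    (\prod_i w i ^+ s i) *: 'X_[s] :> {mpoly R[n]}.
  rewrite comp_mpolyX -mul_mpolyC rmorph_prod /= [X in _ = _ * X]mpolyXE_id -big_split /=.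
  by apply: eq_bigr => i _; rewrite tnth_mktuple -mul_mpolyC exprMn rmorphXn.
rewrite {1}(mpolyE p) (raddf_sum (comp_mpoly _)) raddf_sum /=.
have [ap|ap] := boolP (a \in msupp p); last first.
  rewrite (memN_msupp_eq0 ap) mul0r big_seq big1 // => s sp.
  rewrite comp_mpolyZ e !mcoeffZ mcoeffX; case: eqP => [sa|]; last by rewrite !mulr0.
  by rewrite -sa sp in ap.
rewrite (bigD1_seq a) ?msupp_uniq //= big1 ?addr0 => [|s sa].
  by rewrite comp_mpolyZ e !mcoeffZ mcoeffX eqxx mulr1.
by rewrite comp_mpolyZ e !mcoeffZ mcoeffX (negPf sa) !mulr0.
Qed.

(* [2 ^ j.+1 * b j = J * k] with [J] odd. *)
Lemma alternating_recurrence_dvd n k (b : nat -> nat) :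
  (2 * b 0 = k)%N -> (forall j, j.+1 < n -> 2 * b j.+1 + b j = k)%N ->
  (0 < n)%N -> (2 ^ n %| k)%N.
Proof.
move=> b0 bS n0.
have H j : (j < n)%N -> exists J, [/\ odd J, (J <= 2 ^ j)%N & (2 ^ j.+1 * b j = J * k)%N].
  elim: j => [|j IH] jn.
    by exists 1%N; rewrite mul1n expn1.
  have [J [oJ leJ eJ]] := IH (ltnW jn).
  have leJ' : (J <= 2 ^ j.+1)%N by rewrite expnS; lia.
  exists (2 ^ j.+1 - J)%N; split; last 1 first.
  - rewrite mulnBl -eJ -(bS _ jn) mulnDr addnK [(2 ^ j.+2)%N]expnS.
    by rewrite [RHS]mulnCA mulnA.
  - by rewrite oddB // oddX oJ.
  - by rewrite leq_subr.
have [J [oJ _ eJ]] : exists J, [/\ odd J, (J <= 2 ^ n.-1)%N & (2 ^ n * b n.-1 = J * k)%N].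
  by have := H n.-1; rewrite prednK //; apply.
have : (2 ^ n %| J * k)%N by rewrite -eJ dvdn_mulr.
by rewrite Gauss_dvdr // coprimeXl // coprime2n.
Qed.

(** * Restriction of invariants to chain cubics *)

Section Torus.
Variables (K : closedFieldType) (n : nat).
Hypothesis n_gt0 : (0 < n)%N.
Local Notation m := n.+1.
Local Notation N := (dimU m).

Definition chain_mon (i : 'I_m) : 'X_{1..m} := (U_(i) *+ 2 + U_(nxt i))%MM.

Lemma mdeg_chain_mon i : mdeg (chain_mon i) = 3.
Proof. by rewrite mdegD mdegMn !mdeg1. Qed.

Definition chain_cubics (c : 'I_m -> K) : 'I_N -> K := fun k =>
  let e : coordU m := enum_val k in
  if e.1 == ord0 then \sum_i c i * (chain_mon i == (val e.2 : 'X_{1..m}))%:R else 0.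

Lemma cub_chain_cubics c (i : 'I_3) : cub (chain_cubics c) i =
  if i == ord0 then \sum_j c j *: 'X_[chain_mon j] else 0.
Proof.
apply: eq_dhomog3; first exact: cub_homog.
  case: ifP => _; last exact: dhomog0.
  by apply: rpred_sum => j _; apply: dhomogZ; rewrite dhomogX; apply/eqP/mdeg_chain_mon.
move=> s; rewrite mcoeff_cub /chain_cubics enum_rankK /=.
case: ifP => _; last by rewrite mcoeff0.
by rewrite raddf_sum /=; apply: eq_bigr => j _; rewrite mcoeffZ mcoeffX.
Qed.

Definition torus_weight (t : 'rV[K]_m) (i : 'I_m) : K :=
  \prod_j t 0 j ^+ chain_mon i j.

Lemma act_torus (t : 'rV[K]_m) c :
  actU (diag_mx t) (chain_cubics c) =1 chain_cubics (fun i => torus_weight t i * c i).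
Proof.
apply: eq_cub => i; rewrite cub_act !cub_chain_cubics; case: ifP => _; last exact: raddf0.
rewrite (raddf_sum (comp_mpoly _)) /=; apply: eq_bigr => j _.
rewrite comp_mpolyZ mulrC -scalerA; congr (_ *: _).
rewrite comp_mpolyX -mul_mpolyC rmorph_prod /= [X in _ = _ * X]mpolyXE_id -big_split /=.
apply: eq_bigr => k _; rewrite tnth_lin_subst (bigD1 k) //= mxE eqxx.
rewrite big1 ?addr0 => [|u uk]; first by rewrite -mul_mpolyC exprMn rmorphXn.
by rewrite mxE eq_sym (negPf uk) scale0r.
Qed.

(** The exponent of [t 0 j] in the factor by which the torus scales the monomial [a] in the
    coefficients [c]. *)
Definition row_weight (a : 'X_{1..m}) (j : 'I_m) : nat :=
  (2 * a j + \sum_(i | nxt i == j) a i)%N.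

Lemma row_weightE a j : row_weight a j = (\sum_i chain_mon i j * a i)%N.
Proof.
have -> : (\sum_i chain_mon i j * a i = \sum_i (i == j) * (2 * a i) +
    \sum_i (nxt i == j) * a i)%N.
  rewrite -big_split /=; apply: eq_bigr => i _.
  by rewrite /chain_mon mnmDE mulmnE !mnm1E mulnDl mulnA [(_ * 2)%N]mulnC -!mulnA mulnCA.
congr (_ + _)%N.
  by rewrite (bigD1 j) //= eqxx mul1n big1 ?addn0 // => i /negPf ->.
by rewrite big_mkcond; apply: eq_bigr => i _; case: eqP; rewrite ?mul1n.
Qed.

Lemma exp_eq_inj (e f : nat) : (forall z : K, z != 0 -> z ^+ e = z ^+ f) -> e = f.
Proof.
move=> H; apply/eqP/negPn/negP => ef.
(* The factor ['X] makes the non-root nonzero. *)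
have : 'X * ('X^e - 'X^f) != 0 :> {poly K}.
  rewrite mulf_neq0 ?polyX_eq0 // subr_eq0; apply: contra ef.
  move=> /eqP /(congr1 (fun p : {poly K} => size p)).
  by rewrite !size_polyXn => -[->].
move/closed_nonrootP => [z]; rewrite /root !hornerE mulf_eq0 negb_or => /andP [z0].
by rewrite H // subrr eqxx.
Qed.

(** The one-parameter subgroup with [z] at [i] and its inverse at [nxt i] scales the monomial [a] by
    [z] to the difference of the two weights; this factor is 1 because [a] occurs in [Q]. *)
Lemma row_weight_const (a : 'X_{1..m}) (Q : {mpoly K[m]}) :
  (forall (t : 'rV[K]_m) (c : 'I_m -> K), \prod_j t 0 j = 1 ->
     Q.@[fun i => torus_weight t i * c i] = Q.@[c]) ->
  a \in msupp Q -> forall i : 'I_m, (i < n)%N -> row_weight a i = row_weight a (nxt i).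
Proof.
move=> HQ aQ i ilt; apply: exp_eq_inj => z z0.
have ni : nxt i != i.
  by rewrite -val_eqE /= val_nxt (minn_idPl ilt) gtn_eqF.
pose t : 'rV[K]_m := \row_j (if j == i then z else if j == nxt i then z^-1 else 1).
have prodt (f : 'I_m -> nat) : \prod_j t 0 j ^+ f j = z ^+ f i * z^-1 ^+ f (nxt i).
  rewrite (bigD1 i) //= mxE eqxx (bigD1 (nxt i)) //= mxE (negPf ni) eqxx.
  rewrite big1 ?mulr1 // => j /andP [ji jn].
  by rewrite mxE (negPf ji) (negPf jn) expr1n.
have t1 : \prod_j t 0 j = 1.
  have := prodt (fun=> 1%N); under eq_bigr do rewrite expr1.
  by move=> ->; rewrite !expr1 divff.
have eQ : Q \mPo [tuple torus_weight t i *: 'X_i | i < m] = Q.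
  apply/eqP; rewrite -subr_eq0; apply/eqP/mpoly_eval_eq0 => c.
  rewrite mevalB comp_mpoly_meval -[X in _ - X](HQ t c t1); apply/eqP.
  rewrite subr_eq0; apply/eqP/meval_eq => k.
  by rewrite tnth_mktuple mevalZ mevalXU.
have := congr1 (mcoeff a) eQ; rewrite mcoeff_scale_vars -[RHS]mulr1.
move/mulfI; rewrite -mcoeff_msupp => /(_ aQ).
have -> : \prod_k torus_weight t k ^+ a k = \prod_j t 0 j ^+ row_weight a j.
  under eq_bigr do rewrite /torus_weight -prodrXl.
  rewrite exchange_big /=; apply: eq_bigr => j _.
  under eq_bigr do rewrite -exprM.
  by rewrite row_weightE expr_sum.
rewrite prodt exprVn => e; rewrite -[LHS]mulr1 -(mulVf (expf_neq0 (row_weight a (nxt i)) z0)).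
by rewrite mulrA e mul1r.
Qed.

Lemma balanced_weight_large (a : 'X_{1..m}) : a != 0%MM ->
  (forall i : 'I_m, (i < n)%N -> row_weight a i = row_weight a (nxt i)) ->
  (2 ^ n.-1 <= mdeg a)%N.
Proof.
move=> a0 H.
pose k := row_weight a ord0.
have Hk j : (j <= n)%N -> row_weight a (inord j) = k.
  elim: j => [|j IH] jn.
    by congr row_weight; apply/val_inj; rewrite /= inordK.
  rewrite -(IH (ltnW jn)) (H (inord j)); last by rewrite inordK // ltnW.
  by congr row_weight; apply/val_inj; rewrite /= val_nxt !inordK ?(minn_idPl _) // ltnW.
have k0 : (0 < k)%N.
  rewrite lt0n; apply: contra_neq a0 => k0; apply/mnmP => j; rewrite mnm0E.
  have : row_weight a j = 0%N by rewrite -[j]inord_val Hk // -ltnS.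
  by rewrite /row_weight => /eqP; rewrite addn_eq0 muln_eq0 /= => /andP [/eqP].
(* As [n] is positive, [nxt] sends no index to 0. *)
have e0 : (2 * a (inord 0))%N = k.
  rewrite -(Hk 0%N) // /row_weight big1 ?addn0 // => i /eqP /(congr1 val) /=.
  rewrite val_nxt inordK // => /eqP; rewrite -leqn0 geq_min ltn0 leqn0 /=.
  by rewrite eqn0Ngt n_gt0.
(* The bound [j.+1 < n] avoids the last index, whose two preimages would add a further term. *)
have eS j : (j.+1 < n)%N -> (2 * a (inord j.+1) + a (inord j))%N = k.
  move=> jn; have sum1 : (\sum_(i | nxt i == inord j.+1) a i)%N = a (inord j).
    rewrite (bigD1 (inord j)) /=; last first.
      rewrite -val_eqE /= val_nxt !inordK ?(minn_idPl _) //; lia.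
    rewrite big1 ?addn0 // => i /andP [/eqP /(congr1 val) /= e /negP ij]; case: ij.
    move: e; rewrite val_nxt inordK; last by lia.
    move=> e; rewrite -val_eqE /= inordK; last by lia.
    by apply/eqP; move: e; rewrite /minn; case: ifP => _; lia.
  by rewrite -[RHS](Hk j.+1 (ltnW jn)) /row_weight sum1.
have := alternating_recurrence_dvd (b := fun j => a (inord j)) e0 eS n_gt0.
move/(dvdn_leq k0); have -> : (2 ^ n = 2 * 2 ^ n.-1)%N by rewrite -expnS prednK.
rewrite -e0 leq_pmul2l // => le.
by apply: leq_trans le _; rewrite mdegE (bigD1 (inord 0)) //= leq_addr.
Qed.

Lemma low_degree_invariant (Q : {mpoly K[N]}) :
  is_invariant (@inSL K m) (@actU K m) Q -> (msize Q <= 2 ^ n.-1)%N ->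
  Q.@[chain_cubics (fun=> 1)] = Q.@[fun=> 0].
Proof.
move=> invQ szQ.
(* The coordinates of [chain_cubics c] are linear forms in [c], so the restriction [Q'] has no
   monomial of degree [msize Q] or more. *)
pose lin (k : 'I_N) : {mpoly K[m]} := let e : coordU m := enum_val k in
  if e.1 == ord0 then \sum_i (chain_mon i == (val e.2 : 'X_{1..m}))%:R *: 'X_i else 0.
pose Q' := Q \mPo [tuple lin k | k < N].
have Q'E c : Q'.@[c] = Q.@[chain_cubics c].
  rewrite /Q' comp_mpoly_meval; apply: meval_eq => k.
  rewrite tnth_mktuple /lin /chain_cubics; case: ifP => _; last exact: meval0.
  rewrite (raddf_sum (meval c)) /=; apply: eq_bigr => i _.
  by rewrite mevalZ mevalXU mulrC.
have Q'inv (t : 'rV[K]_m) (c : 'I_m -> K) : \prod_j t 0 j = 1 ->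
    Q'.@[fun i => torus_weight t i * c i] = Q'.@[c].
  move=> t1; rewrite !Q'E -(meval_eq _ (act_torus t c)); apply: invQ.
  by rewrite /inSL det_diag.
have linh k : tnth [tuple lin k | k < N] k \is 1.-homog.
  rewrite tnth_mktuple /lin; case: ifP => _; last exact: dhomog0.
  by apply: rpred_sum => i _; apply: dhomogZ; rewrite dhomogX; apply/eqP/mdeg1.
have Q'const a : a \in msupp Q' -> a = 0%MM.
  move=> aQ; apply/eqP/negPn/negP => a0.
  have le := balanced_weight_large a0 (row_weight_const Q'inv aQ).
  move: aQ; rewrite mcoeff_msupp mcoeff_linear_comp_eq0 ?eqxx //.
  exact: leq_trans le.
have -> : Q.@[fun=> 0] = Q'.@[fun=> 0].
  rewrite Q'E; apply: meval_eq => k; rewrite /chain_cubics.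
  by case: ifP => // _; rewrite big1 // => i _; rewrite mul0r.
rewrite -Q'E !mevalE big_seq [RHS]big_seq; apply: eq_bigr => a /Q'const ->.
by congr (_ * _); apply: eq_bigr => i _; rewrite mnm0E !expr0.
Qed.

Lemma cubics_beta_ge : (2%:R : K) != 0 ->
  beta_ge (@inSL K m) (@actU K m) (2 ^ n.-1).
Proof.
move=> two d gen; rewrite leqNgt; apply/negP => dlt.
have e0 : cub (chain_cubics (fun=> 1)) ord0 = chain_cubic K n.
  rewrite cub_chain_cubics eqxx; apply: eq_bigr => i _.
  by rewrite scale1r /chain_mon mpolyXD mpolyXn.
have [Q [invQ Qn0 Q0]] := discriminant_exists two e0.
have [k [gs [gsP [R eQ]]]] := gen _ invQ.
case/negP: Qn0; rewrite -Q0 eQ !comp_mpoly_meval; apply/eqP/meval_eq => i.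
have [invg szg] := gsP i; apply: low_degree_invariant => //.
(* The bound [d.+1] on [msize] matches the strict inequality [dlt]. *)
exact: leq_trans szg dlt.
Qed.

End Torus.

(** The integer division is exact, since 3 divides [4 ^ n - 1]. *)
Theorem theorem2p8 (K : closedFieldType) (n : nat) :
  (2%:R : K) != 0 ->
  beta_ge (@inSL K (3 * n)) (@actU K (3 * n))
    ((2 * (4 ^ n - 1)) %/ 3)%N.
Proof.
case: n => [|n] two; first by move=> d _.
have e : (3 * n.+1 = (3 * n + 2).+1)%N by lia.
rewrite e => d gen; have := @cubics_beta_ge K (3 * n + 2) _ two d gen.
rewrite addn2 /= => /(_ isT); apply: leq_trans.
(* In [3 * n.+1] variables the chain gives the bound [2 ^ (3 * n).+1]. It coincides with the claimed
   one for three variables, and beyond that 8^k dominates 4^k. *)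
have H : (2 * (4 ^ n.+1 - 1) <= 3 * 2 ^ (3 * n).+1)%N.
  case: (n) => [|k] //.
  have le : (4 ^ k <= 8 ^ k)%N by case: (k) => [|j] //; rewrite leq_exp2r.
  have -> : (2 ^ (3 * k.+1).+1 = 2 * (8 * 8 ^ k))%N by rewrite expnS expnM expnS.
  by rewrite !(expnS 4); lia.
by rewrite -[X in (_ <= X)%N](@mulKn _ 3) //; apply: leq_div2r.
Qed.
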